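(* Let $b$ be a contractive multiplier of $H^2_d$ that is not a unimodular constant, let $\{\mu_\alpha\}_{\alpha\in\mathbb T}$ be the Aleksandrov–Clark (AC) states for $b$, let $m$ be normalized Lebesgue measure on the unit circle $\mathbb T$, and let $m_\varnothing$ be the vacuum state on $\overline{\mathcal S+\mathcal S^*}$. Then for every $f\in\overline{\mathcal S+\mathcal S^*}$ the function $\alpha\mapsto\mu_\alpha(f)$ is continuous on $\mathbb T$, and $$\int_{\mathbb T}\mu_\alpha(f)\,dm(\alpha)=m_\varnothing(f).$$
   Context: Fix an integer $d\ge 1$; $\mathbb B^d$ is the open unit ball of $\mathbb C^d$, $\lambda^*$ denotes the complex conjugate of a scalar, and $zw^*=\sum_{j=1}^d z_jw_j^*$. $H^2_d$ (Drury–Arveson space) is the reproducing kernel Hilbert space on $\mathbb B^d$ with kernel $\frac1{1-zw^*}$. A contractive multiplier $b$ is a holomorphic function on $\mathbb B^d$ with $bf\in H^2_d$ and $\|bf\|\le\|f\|$ for all $f\in H^2_d$. $\mathbb F_d^+$ is the free semigroup of finite words in $1,\dots,d$ (including the empty word $\varnothing$); on $\ell^2(\mathbb F_d^+)$ with orthonormal basis $\{\xi_w\}$ put $L_i\xi_w=\xi_{iw}$, so $L_i^*L_j=\delta_{ij}I$. For $\mathbf n\in\mathbb N^d$ (nonnegative integers), $L^{(\mathbf n)}$ is the sum of all distinct words (products) in the $L_i$ containing exactly $n_i$ factors $L_i$ for each $i$; $L^{(\mathbf 0)}=I$. $\mathcal S$ is the norm-closed linear span of all $L^{(\mathbf n)}$,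 $\mathcal S^*$ the set of adjoints of its elements, and $\overline{\mathcal S+\mathcal S^*}$ is the operator norm closure. Put $z\mathbf L^*=\sum_j z_jL_j^*$. A state means a positive linear functional (not necessarily normalized) on $\mathcal S+\mathcal S^*$, identified with its unique positive extension to $\overline{\mathcal S+\mathcal S^*}$. For $\alpha\in\mathbb T$ the AC state $\mu_\alpha$ of $b$ is the unique state such that for all $z\in\mathbb B^d$ $$\frac{1+\alpha^*b(z)}{1-\alpha^*b(z)}=\mu_\alpha\big((I+z\mathbf L^* )(I-z\mathbf L^* )^{-1}\big)+i\,\mathrm{Im}\Big(\frac{1+\alpha^*b(0)}{1-\alpha^*b(0)}\Big).$$ The vacuum state is $m_\varnothing(f)=\langle f\xi_\varnothing,\xi_\varnothing\rangle$. *)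

(* Defs.v *)
From HB Require Import structures.
From mathcomp Require Import all_boot all_order all_algebra.
From mathcomp Require Import all_classical all_reals all_analysis.
From mathcomp Require Import complex ring lra.

Set Implicit Arguments.
Unset Strict Implicit.
Unset Printing Implicit Defensive.

Import Order.TTheory GRing.Theory Num.Theory.
Import numFieldNormedType.Exports.

Local Open Scope classical_set_scope.
Local Open Scope ring_scope.

(* Keeping the structure folded lets 'R[i]' inherit the topology and the norm
   that the library puts on every 'numClosedFieldType'. *)
Definition Cplx (R : realType) : numClosedFieldType := R[i].

Definition cRe (R : realType) (z : Cplx R) : R := complex.Re z.
Definition cIm (R : realType) (z : Cplx R) : R := complex.Im z.
Definition mkC (R : realType) (x y : R) : Cplx R := Complex x y.

(* A form 'ip' is only meaningful on the subspace 'H' of 'V'; all inner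
   products are linear in the first variable. *)
Definition hnorm (R : realType) (V : Type) (ip : V -> V -> Cplx R) (x : V) : R :=
  Num.sqrt (cRe (ip x x)).

Record hilbert_subspace (R : realType) (V : lmodType (Cplx R)) (H : set V)
    (ip : V -> V -> Cplx R) : Prop := HilbertSubspace {
  hs_zero : H 0 ;
  hs_lin : forall (a : Cplx R) (x y : V), H x -> H y -> H (a *: x + y) ;
  hs_ip_lin : forall (a : Cplx R) (x y z : V), H x -> H y -> H z ->
    ip (a *: x + y) z = a * ip x z + ip y z ;
  hs_ip_sym : forall x y, H x -> H y -> ip y x = (ip x y)^* ;
  hs_ip_ge0 : forall x, H x -> 0 <= ip x x ;
  hs_ip_eq0 : forall x, H x -> ip x x = 0 -> x = 0 ;
  hs_complete : forall u : nat -> V, (forall n, H (u n)) ->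
    (forall e : R, 0 < e -> exists N : nat, forall m n : nat,
       (N <= m)%N -> (N <= n)%N -> hnorm ip (u m - u n) < e) ->
    exists2 x, H x & (fun n => hnorm ip (u n - x)) @ \oo --> (0 : R) }.

(* By the Moore-Aronszajn theorem such a structure exists and is unique (as a
   set of functions with an inner product) for each positive kernel. *)
Record rkhs (R : realType) (X : Type) (k : X -> X -> Cplx R) := RKHS {
  rk_space : set (X -> Cplx R) ;
  rk_ip : (X -> Cplx R) -> (X -> Cplx R) -> Cplx R ;
  rk_hilbert : hilbert_subspace rk_space rk_ip ;
  rk_kernel : forall w, rk_space (fun z => k z w) ;
  rk_reproducing : forall f w, rk_space f -> rk_ip f (fun z => k z w) = f w }.

Section DruryArveson.
Variables (R : realType) (d : nat).
Local Notation C := (Cplx R).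

Definition rdot (z w : 'rV[C]_d) : C := \sum_(j < d) z 0 j * (w 0 j)^*.

Definition Bd : set 'rV[C]_d := [set z | \sum_(j < d) `|z 0 j| ^+ 2 < 1].

Definition DAkernel (z w : set_type Bd) : C := (1 - rdot (val z) (val w))^-1.

(* Only the values of 'b' on the ball matter, here and below; 'differentiable'
   is Frechet differentiability over the field 'C'. *)
Definition holomorphic (b : 'rV[C]_d -> C) : Prop :=
  forall z, Bd z -> differentiable b z.

Definition contractive_multiplier (H2 : rkhs DAkernel) (b : 'rV[C]_d -> C) : Prop :=
  holomorphic b /\
  forall f, rk_space H2 f ->
    rk_space H2 (fun z => b (val z) * f z) /\
    hnorm (rk_ip H2) (fun z => b (val z) * f z) <= hnorm (rk_ip H2) f.

Definition unimodular_constant (b : 'rV[C]_d -> C) : Prop :=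
  exists2 c : C, `|c| = 1 & forall z, Bd z -> b z = c.

End DruryArveson.

Section FockSpace.
Variables (R : realType) (d : nat).
Local Notation C := (Cplx R).

Definition word := seq 'I_d.

(* the real number |z|^2 *)
Definition absq (z : C) : R := cRe z ^+ 2 + cIm z ^+ 2.

Definition square_summable : {pred (word -> C)} :=
  fun x => `[< (\esum_(w in [set: word]) (absq (x w))%:E < +oo)%E >].

Lemma absq_ge0 z : 0 <= absq z.
Proof. by rewrite addr_ge0 ?sqr_ge0. Qed.

Lemma absqD z t : absq (z + t) <= 2 * absq z + 2 * absq t.
Proof.
case: z t => [a b] [c e]; rewrite /absq /cRe /cIm /=.
have := sqr_ge0 (a - c); have := sqr_ge0 (b - e); nra.
Qed.

Lemma absqM z t : absq (z * t) = absq z * absq t.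
Proof. by case: z t => [a b] [c e]; rewrite /absq /cRe /cIm /=; ring. Qed.

Lemma square_summable_submod : submod_closed square_summable.
Proof.
split.
  apply/asboolP; rewrite esum1 ?ltry// => w _.
  by rewrite /absq /cRe /cIm /= expr0n /= addr0.
move=> a x y /asboolP sx /asboolP sy; apply/asboolP.
pose m : R := 2 * absq a.
have m0 : 0 <= m by rewrite mulr_ge0 ?absq_ge0.
have Z (c : R) (z : word -> C) : 0 <= c ->
  (\esum_(w in [set: word]) (absq (z w))%:E < +oo)%E ->
  (\esum_(w in [set: word]) (c * absq (z w))%:E < +oo)%E.
  move=> c0 sz; set M := esum _ _ in sz.
  have M0 : (0 <= M)%E by apply: esum_ge0 => w _; rewrite lee_fin absq_ge0.
  apply: (@le_lt_trans _ _ (c%:E * M)%E); last first.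
    by case: (M) sz M0 => // r _ _; rewrite -EFinM ltry.
  apply: ge_ereal_sup => _ [F [finF _] <-].
  under eq_fsbigr do rewrite EFinM.
  rewrite -ge0_mule_fsumr; last by move=> w; rewrite lee_fin absq_ge0.
  apply: lee_wpmul2l; first by rewrite lee_fin.
  by apply: ereal_sup_ubound; exists F.
apply: (@le_lt_trans _ _ (\esum_(w in [set: word])
    ((m * absq (x w))%:E + (2 * absq (y w))%:E))%E).
  apply: le_esum => w _; rewrite -EFinD lee_fin /m -mulrA -absqM.
  exact: absqD.
rewrite esumD; first 1 last.
- by move=> w _; rewrite lee_fin mulr_ge0 ?absq_ge0.
- by move=> w _; rewrite lee_fin mulr_ge0 ?absq_ge0.
by rewrite lte_add_pinfty// Z.
Qed.

HB.instance Definition _ :=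
  GRing.isSubmodClosed.Build C (word -> C) square_summable
    square_summable_submod.

Record ell2 := Ell2 { ell2_fun :> word -> C ; _ : ell2_fun \in square_summable }.
HB.instance Definition _ := [isSub for ell2_fun].
HB.instance Definition _ := gen_eqMixin ell2.
HB.instance Definition _ := gen_choiceMixin ell2.
HB.instance Definition _ := [SubChoice_isSubLmodule of ell2 by <:].

Definition dirac_fun (v : word) : word -> C := fun w => (w == v)%:R.

Lemma dirac_subproof v : dirac_fun v \in square_summable.
Proof.
apply/asboolP; apply: (@le_lt_trans _ _ 1%E); last exact: ltry.
apply: ge_ereal_sup => _ [F [finF _] <-].
have [vF|vF] := pselect (F v).
  rewrite (fsbigD1 v)//= fsbig1 => [|w [_ /= /eqP/negbTE wv]].
    by rewrite adde0 /dirac_fun eqxx /absq /cRe /cIm /= expr1n expr0n /= addr0.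
  by rewrite /dirac_fun wv /absq /cRe /cIm /= expr0n /= addr0.
rewrite fsbig1// => w Fw; rewrite /dirac_fun; case: eqP => [wv|_].
  by rewrite wv in Fw.
by rewrite /absq /cRe /cIm /= expr0n /= addr0.
Qed.

Definition xi (v : word) : ell2 := Ell2 (dirac_subproof v).

Definition shift_fun (i : 'I_d) (x : word -> C) : word -> C :=
  fun w => if w is j :: v then (if j == i then x v else 0) else 0.

Lemma shift_subproof i (x : ell2) : shift_fun i x \in square_summable.
Proof.
case: x => x /= /asboolP sx; apply/asboolP; apply: le_lt_trans sx.
have z0 : absq 0 = 0 by rewrite /absq /cRe /cIm /= expr0n /= addr0.
have injc : set_inj [set: word] (cons i) by move=> u v _ _ [].
rewrite (_ : esum _ _ =
    \esum_(w in cons i @` [set: word]) (absq (shift_fun i x w))%:E); last first.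
  rewrite [RHS]esum_mkcond; apply: eq_esum => w _; case: ifPn => //.
  rewrite notin_setE => nw; case: w nw => [|j v] nw /=; rewrite ?z0//.
  by case: eqP => [ji|_]; [case: nw; exists v; rewrite // ji | rewrite z0].
by rewrite (esum_image _ (cons i))//=; under eq_esum do rewrite eqxx.
Qed.

(* the left creation operator: L_i xi_w = xi_(i :: w) *)
Definition Lop (i : 'I_d) (x : ell2) : ell2 := Ell2 (shift_subproof i x).

Lemma Lop_xi i w : Lop i (xi w) = xi (i :: w).
Proof.
apply/val_inj/funext => -[|j v] //=; rewrite /dirac_fun /= eqseq_cons.
by case: (j == i).
Qed.

(* The sum over all words, taken by increasing word length; it converges
   absolutely for square-summable families. *)
Definition dotp (x y : ell2) : C :=
  limn (fun n => \sum_(k < n) \sum_(w : k.-tuple 'I_d) x w * (y w)^* : C).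

Definition op := ell2 -> ell2.

Definition opnorm (T : op) : \bar R :=
  ereal_sup [set (hnorm dotp (T x))%:E | x in [set x | hnorm dotp x <= 1]].

Definition bounded_op (T : op) : Prop :=
  (forall (a : C) x y, T (a *: x + y) = a *: T x + T y) /\ (opnorm T < +oo)%E.

Definition opclosure (V : set op) : set op :=
  [set T | bounded_op T /\
    forall e : R, 0 < e -> exists2 U, V U & (opnorm (T - U)%R < e%:E)%E].

Definition is_adjoint (T U : op) : Prop :=
  bounded_op U /\ forall x y, dotp (T x) y = dotp x (U y).

(* 'adj T' and 'opinv T' default to 0 when there is no adjoint (resp. no
   bounded inverse); they are only used where these exist. *)
Definition adj (T : op) : op := xget 0 [set U | is_adjoint T U].

Definition opinv (T : op) : op :=
  xget 0 [set U | bounded_op U /\ (T \o U = id /\ U \o T = id)].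

Definition positive_op (T : op) : Prop := forall x, 0 <= dotp (T x) x.

Definition Lword (w : word) : op := foldr (fun i T => Lop i \o T) id w.

Definition Lsym (n : 'I_d -> nat) : op :=
  \sum_(w : (\sum_(i < d) n i).-tuple 'I_d | [forall i, count_mem i w == n i])
    Lword w.

Definition span_Lsym : set op :=
  [set T | exists s : seq (C * ('I_d -> nat)), T = \sum_(p <- s) p.1 *: Lsym p.2].

Definition Sspace : set op := opclosure span_Lsym.

Definition Sstar : set op := [set T | exists2 U, Sspace U & is_adjoint U T].

Definition SplusSstar : set op :=
  [set T | exists A B, [/\ Sspace A, Sstar B & T = (A + B)%R]].

Definition SSbar : set op := opclosure SplusSstar.

(* A positive functional on the operator system S + S^* is identified with its
   unique positive extension to the closure, so it is given there directly.
   The values of 'mu' outside 'SSbar' are irrelevant. *)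
Definition is_state (mu : op -> C) : Prop :=
  (forall (a : C) T U, SSbar T -> SSbar U -> mu (a *: T + U) = a * mu T + mu U) /\
  (forall T, SSbar T -> positive_op T -> 0 <= mu T).

Definition vacuum (T : op) : C := dotp (T (xi [::])) (xi [::]).

Definition zLstar (z : 'rV[C]_d) : op := \sum_(j < d) z 0 j *: adj (Lop j).

Definition herglotz_op (z : 'rV[C]_d) : op :=
  (id + zLstar z)%R \o opinv (id - zLstar z)%R.

(* Herglotz transform of 'alpha^* b' *)
Definition cayley (b : 'rV[C]_d -> C) (alpha : C) (z : 'rV[C]_d) : C :=
  (1 + alpha^* * b z) / (1 - alpha^* * b z).

Definition AC_state (b : 'rV[C]_d -> C) (alpha : C) (mu : op -> C) : Prop :=
  is_state mu /\
  forall z, Bd z ->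
    cayley b alpha z = mu (herglotz_op z) + 'i * 'Im (cayley b alpha 0).

End FockSpace.

Section Circle.
Variable R : realType.
Local Notation C := (Cplx R).

Definition Circle : set C := [set z | `|z| = 1].

Definition expi (t : R) : C := mkC (cos t) (sin t).

(* integral of 'g' against normalized Lebesgue measure on the unit circle, i.e.
   the push-forward of dt / (2 pi) under t |-> e^(it), t in [0, 2 pi] *)
Definition circle_integral (g : C -> C) : C :=
  mkC ((2 * pi)^-1 * \int[lebesgue_measure]_(t in `[0, 2 * pi]) cRe (g (expi t)))
      ((2 * pi)^-1 * \int[lebesgue_measure]_(t in `[0, 2 * pi]) cIm (g (expi t))).

End Circle.

(* Main.v *)
Require Import Defs.
From HB Require Import structures.
From mathcomp Require Import all_boot all_order all_algebra.
From mathcomp Require Import all_classical all_reals all_analysis.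
From mathcomp Require Import complex ring lra.

Set Implicit Arguments.
Unset Strict Implicit.
Unset Printing Implicit Defensive.

Import Order.TTheory GRing.Theory Num.Theory.
Import numFieldNormedType.Exports.

Local Open Scope classical_set_scope.
Local Open Scope ring_scope.

(** For a point [z] of the ball with [sum_j |z_j| <= 1/2], the Neumann series
    of [A = z L^*] converges and the Herglotz operator of [z] is [2 U - 1] with
    [U = (1 - A)^-1]. The defining equation of the state [mu_a] computes it on
    this operator: the value is [(1 + a^* b(z)) / (1 - a^* b(z))] minus [i]
    times the imaginary part of the same expression at [0]. As functions of [a]
    on the circle, both terms are continuous. The first has mean [1], because
    only the constant term of the geometric series in [a^* b(z)] survives
    integration ([has_mean_cayley]), so the second has mean [0]. On the other
    side the vacuum vector is killed by [A], so the vacuum state of the Herglotz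
    operator is also [1]. The theorem therefore holds on Herglotz operators.

    The set [W] of operators for which it holds is a subspace, it is stable
    under adjoints, since a state commutes with adjoints ([state_adjoint]), and
    it is norm closed, since [|mu_a(T)| <= 2 |T| mu_a(1)] ([state_bound]) with
    [mu_a(1) = Re ((1 + a^* b(0)) / (1 - a^* b(0)))] bounded in [a]
    ([AC_mass_le]).

    It remains to see that such a [W] is everything ([SSbar_dense]). Replacing
    [z] by [t z] and letting [t] tend to [0] extracts from [U] the powers [A^k]
    one after the other ([extract_coefficients]); their adjoints are the
    homogeneous sums of creation operators, with the word [w] weighted by the
    product of the [z_j^*] along it. Choosing [z_j = t ^ ((k+1)^j)] gives the
    words with different letter counts different powers of [t], and the same
    extraction isolates every [L^(n)].

    All of this requires [|b(z)| < 1]. It follows from positivity of the kernel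
    [(1 - b(z) b(w)^* ) k(z, w)] at the two points [0] and [z]: if [|b(0)| = 1]
    the off-diagonal entry [1 - b(0) b(z)^* ] vanishes for every [z] and [b] is
    a unimodular constant, and if [|b(z)| = 1] the same entry vanishes at [z],
    forcing [|b(0)| = 1] ([contractive_multiplier_lt1]). *)

(** * Complex numbers *)

Section ComplexNumbers.
Variable R : realType.
Local Notation C := (Cplx R).
Implicit Types z t : C.

Lemma cplx_eq z t : cRe z = cRe t -> cIm z = cIm t -> z = t.
Proof. by case: z t => [a b] [c e]; rewrite /cRe /cIm /= => -> ->. Qed.

Lemma cReD z t : cRe (z + t) = cRe z + cRe t. Proof. by case: z t => [a b] [c e]. Qed.
Lemma cImD z t : cIm (z + t) = cIm z + cIm t. Proof. by case: z t => [a b] [c e]. Qed.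
Lemma cReN z : cRe (- z) = - cRe z. Proof. by case: z. Qed.
Lemma cImN z : cIm (- z) = - cIm z. Proof. by case: z. Qed.
Lemma cReM z t : cRe (z * t) = cRe z * cRe t - cIm z * cIm t.
Proof. by case: z t => [a b] [c e]. Qed.
Lemma cImM z t : cIm (z * t) = cRe z * cIm t + cIm z * cRe t.
Proof. by case: z t => [a b] [c e]. Qed.
Lemma cRe0 : cRe (0 : C) = 0. Proof. by []. Qed.
Lemma cIm0 : cIm (0 : C) = 0. Proof. by []. Qed.
Lemma cRe1 : cRe (1 : C) = 1. Proof. by []. Qed.
Lemma cIm1 : cIm (1 : C) = 0. Proof. by []. Qed.
Lemma cReC z : cRe (z^*) = cRe z. Proof. by case: z. Qed.
Lemma cImC z : cIm (z^*) = - cIm z. Proof. by case: z. Qed.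
Lemma cRemk (x y : R) : cRe (mkC x y) = x. Proof. by []. Qed.
Lemma cImmk (x y : R) : cIm (mkC x y) = y. Proof. by []. Qed.
Lemma cImV z : cIm (z^-1) = - cIm z / absq z.
Proof. by case: z => a e; rewrite /cRe /cIm /absq /= mulNr. Qed.

Definition cmod z : R := Num.sqrt (absq z).

Lemma cnormE z : `|z| = mkC (cmod z) 0.
Proof. by case: z => a e; rewrite /cRe /cIm /absq /=. Qed.

Lemma cleE z t : (z <= t) = (cIm t == cIm z) && (cRe z <= cRe t).
Proof. by case: z t => [a b] [c e]. Qed.
Lemma cltE z t : (z < t) = (cIm t == cIm z) && (cRe z < cRe t).
Proof. by case: z t => [a b] [c e]. Qed.

Lemma cmod_ge0 z : 0 <= cmod z. Proof. exact: sqrtr_ge0. Qed.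

Lemma cmod2 z : cmod z ^+ 2 = absq z.
Proof. by rewrite sqr_sqrtr ?absq_ge0. Qed.

Lemma cmodD z t : cmod (z + t) <= cmod z + cmod t.
Proof. by have := ler_normD z t; rewrite !cnormE cleE /= => /andP[]. Qed.

Lemma cmodM z t : cmod (z * t) = cmod z * cmod t.
Proof. by rewrite /cmod absqM sqrtrM ?absq_ge0. Qed.

Lemma cmodN z : cmod (- z) = cmod z.
Proof. by rewrite /cmod /absq cReN cImN !sqrrN. Qed.

Lemma cmodBC z t : cmod (z - t) = cmod (t - z).
Proof. by rewrite -cmodN opprB. Qed.

Lemma cmodC z : cmod (z^*) = cmod z.
Proof. by rewrite /cmod /absq cReC cImC sqrrN. Qed.

Lemma cmod0 : cmod (0 : C) = 0.
Proof. by rewrite /cmod /absq cRe0 cIm0 expr0n /= addr0 sqrtr0. Qed.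

Lemma cmod1 : cmod (1 : C) = 1.
Proof. by rewrite /cmod /absq cRe1 cIm1 expr0n expr1n /= addr0 sqrtr1. Qed.

Lemma cmodX z n : cmod (z ^+ n) = cmod z ^+ n.
Proof. by elim: n => [|n IH]; rewrite ?expr0 ?cmod1// !exprS cmodM IH. Qed.

Lemma absq0 : absq (0 : C) = 0.
Proof. by rewrite /absq cRe0 cIm0 expr0n /= addr0. Qed.

Lemma absq_eq0 z : absq z = 0 -> z = 0.
Proof.
rewrite /absq => /eqP; rewrite paddr_eq0 ?sqr_ge0// !sqrf_eq0.
by move=> /andP[/eqP h /eqP k]; exact: cplx_eq.
Qed.

Lemma cmod_eq0 z : cmod z = 0 -> z = 0.
Proof. by move=> h; apply: absq_eq0; rewrite -cmod2 h expr0n. Qed.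

Lemma cRe_le_cmod z : `|cRe z| <= cmod z.
Proof. by rewrite -sqrtr_sqr ler_wsqrtr// /absq lerDl sqr_ge0. Qed.

Lemma cIm_le_cmod z : `|cIm z| <= cmod z.
Proof. by rewrite -sqrtr_sqr ler_wsqrtr// /absq lerDr sqr_ge0. Qed.

Lemma cmod_le z : cmod z <= `|cRe z| + `|cIm z|.
Proof.
rewrite -ler_sqr ?nnegrE ?cmod_ge0 ?addr_ge0// cmod2 /absq.
rewrite -(real_normK (num_real (cRe z))) -(real_normK (num_real (cIm z))).
have := normr_ge0 (cRe z); have := normr_ge0 (cIm z); nra.
Qed.

Lemma cmod_real (x : R) : cmod (mkC x 0) = `|x|.
Proof. by rewrite /cmod /absq cRemk cImmk expr0n /= addr0 sqrtr_sqr. Qed.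

Lemma mkCX (x : R) n : mkC (x ^+ n) 0 = mkC x 0 ^+ n :> C.
Proof.
elim: n => [|n IH]; first by rewrite !expr0.
by rewrite !exprS -IH; apply: cplx_eq; rewrite ?cReM ?cImM ?cRemk ?cImmk; ring.
Qed.

Lemma mulCJ z : z * z^* = mkC (absq z) 0.
Proof.
by apply: cplx_eq; rewrite ?cReM ?cImM cReC cImC ?cRemk ?cImmk /absq; ring.
Qed.

Lemma cRe_sum I (r : seq I) (P : pred I) (F : I -> C) :
  cRe (\sum_(i <- r | P i) F i) = \sum_(i <- r | P i) cRe (F i).
Proof. by apply: (big_morph _ cReD cRe0). Qed.

Lemma cIm_sum I (r : seq I) (P : pred I) (F : I -> C) :
  cIm (\sum_(i <- r | P i) F i) = \sum_(i <- r | P i) cIm (F i).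
Proof. by apply: (big_morph _ cImD cIm0). Qed.

Lemma cvg_cplxP T (F : set_system T) (FF : Filter F) (u : T -> C) (l : C) :
  (u @ F --> l) <->
  ((fun x => cRe (u x)) @ F --> cRe l /\ (fun x => cIm (u x)) @ F --> cIm l).
Proof.
split.
  move=> /cvgrPdist_lt h; split; apply/cvgrPdist_lt => e e0.
    have e0' : 0 < (mkC e 0 : C) by rewrite cltE eqxx.
    apply: filterS (h _ e0') => x; rewrite cnormE cltE /= => /andP[_].
    by apply: le_lt_trans; rewrite -cReN -cReD cRe_le_cmod.
  have e0' : 0 < (mkC e 0 : C) by rewrite cltE eqxx.
  apply: filterS (h _ e0') => x; rewrite cnormE cltE /= => /andP[_].
  by apply: le_lt_trans; rewrite -cImN -cImD cIm_le_cmod.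
move=> [/cvgrPdist_lt h /cvgrPdist_lt k]; apply/cvgrPdist_lt => e.
rewrite cltE => /andP[/eqP e1 e2].
have e0 : 0 < cRe e / 2 by rewrite divr_gt0.
near=> x; rewrite cnormE cltE /= e1 eqxx /=.
apply: le_lt_trans (cmod_le _) _.
rewrite cReD cReN cImD cImN (splitr (cRe e)) ltrD//.
  by near: x; exact: h.
by near: x; exact: k.
Unshelve. all: by end_near. Qed.

Definition cplxE := (cReD, cImD, cReN, cImN, cReM, cImM, cReC, cImC,
  cRe1, cIm1, cRe0, cIm0, cRemk, cImmk).

End ComplexNumbers.

(** * Forms that are positive on a subspace *)

Section PreInnerProduct.
Variables (R : realType) (V : lmodType (Cplx R)) (H : set V).
Variable ip : V -> V -> Cplx R.
Local Notation C := (Cplx R).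

Record pre_inner_product : Prop := PreInnerProduct {
  pip_zero : H 0 ;
  pip_lin : forall (a : C) (x y : V), H x -> H y -> H (a *: x + y) ;
  pip_ip_lin : forall (a : C) (x y z : V), H x -> H y -> H z ->
    ip (a *: x + y) z = a * ip x z + ip y z ;
  pip_ip_sym : forall x y, H x -> H y -> ip y x = (ip x y)^* ;
  pip_ip_ge0 : forall x, H x -> 0 <= ip x x }.

Hypothesis hip : pre_inner_product.

Lemma pip_linr (a : C) x y z : H x -> H y -> H z ->
  ip z (a *: x + y) = a^* * ip z x + ip z y.
Proof.
move=> hx hy hz; rewrite (pip_ip_sym hip (pip_lin hip a hx hy) hz).
rewrite (pip_ip_lin hip)// rmorphD rmorphM /=.
by rewrite -(pip_ip_sym hip hx hz) -(pip_ip_sym hip hy hz).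
Qed.

Lemma pip_scale (a : C) x : H x -> H (a *: x).
Proof. by move=> hx; rewrite -[_ *: _]addr0; apply: (pip_lin hip) => //; case: hip. Qed.

Lemma pip_0r x : H x -> ip x 0 = 0.
Proof.
move=> hx; rewrite -[X in ip x X](addNr x) -scaleN1r pip_linr//.
by rewrite rmorphN rmorph1 mulN1r addNr.
Qed.

Lemma pip_scaler (a : C) x y : H x -> H y -> ip x (a *: y) = a^* * ip x y.
Proof.
move=> hx hy; rewrite -[_ *: _]addr0 pip_linr ?pip_0r ?addr0//.
by case: hip.
Qed.

Lemma pip_self x : H x -> ip x x = mkC (cRe (ip x x)) 0.
Proof.
move=> /(pip_ip_ge0 hip); rewrite cleE => /andP[/eqP h _].
by apply: cplx_eq; rewrite ?cImmk.
Qed.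

Lemma pip_self_ge0 x : H x -> 0 <= cRe (ip x x).
Proof. by move=> /(pip_ip_ge0 hip); rewrite cleE => /andP[_]. Qed.

Lemma pip_expand (a : C) x y : H x -> H y ->
  cRe (ip (a *: x + y) (a *: x + y)) =
  absq a * cRe (ip x x) + 2 * cRe (a * ip x y) + cRe (ip y y).
Proof.
move=> hx hy; have hxy := pip_lin hip a hx hy.
rewrite pip_linr// !(pip_ip_lin hip)// (pip_ip_sym hip hx hy).
rewrite (pip_self hx) (pip_self hy) /absq.
move: (ip x x) (ip x y) (ip y y) => p q r.
by rewrite !(cReD, cReM, cImD, cImM, cReC, cImC, cRemk, cImmk); ring.
Qed.

Lemma pip_scale_self (a : C) x : H x ->
  cRe (ip (a *: x) (a *: x)) = absq a * cRe (ip x x).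
Proof.
move=> hx; have h0 : H 0 by case: hip.
have := pip_expand a hx h0; rewrite !addr0 => ->.
by rewrite !pip_0r// mulr0 cRe0 mulr0 !addr0.
Qed.

(** Evaluate at [t = 1/q]. If [q = 0] the polynomial is affine in [t], and
    nonnegativity everywhere leaves no room for a nonzero slope. *)
Lemma discriminant_le (p A q : R) : 0 <= A -> 0 <= q ->
  (forall t : R, 0 <= t ^+ 2 * (A * q) - 2 * (t * A) + p) -> A <= p * q.
Proof.
move=> A0 q0 h; have [qe|qn0] := eqVneq q 0; last first.
  have := h q^-1; rewrite -(pmulr_rge0 _ (_ : 0 < q)) ?lt_def ?qn0//.
  have -> : q * (q^-1 ^+ 2 * (A * q) - 2 * (q^-1 * A) + p) = p * q - A by field.
  by rewrite subr_ge0.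
have [->|An0] := eqVneq A 0; first by rewrite qe mulr0.
have := h ((p + 1) / A); rewrite qe mulr0 mulr0 add0r divfK//.
have p0 : 0 <= p by have := h 0; rewrite qe; lra.
lra.
Qed.

Lemma cauchy_schwarz_sq x y : H x -> H y ->
  absq (ip x y) <= cRe (ip x x) * cRe (ip y y).
Proof.
move=> hx hy; rewrite mulrC; apply: discriminant_le;
  rewrite ?absq_ge0 ?pip_self_ge0// => t.
have := pip_self_ge0 (pip_lin hip (mkC (- t) 0 * (ip x y)^*) hx hy).
rewrite pip_expand//; set w := ip x y; congr (_ <= _ + _).
rewrite absqM {1}/absq cRemk cImmk.
rewrite /absq !(cReM, cImM, cReC, cImC, cRemk, cImmk).
by ring.
Qed.

Lemma hnorm_ge0 x : 0 <= hnorm ip x. Proof. exact: sqrtr_ge0. Qed.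

Lemma hnorm2 x : H x -> hnorm ip x ^+ 2 = cRe (ip x x).
Proof. by move=> hx; rewrite sqr_sqrtr ?pip_self_ge0. Qed.

Lemma cauchy_schwarz x y : H x -> H y ->
  cmod (ip x y) <= hnorm ip x * hnorm ip y.
Proof.
move=> hx hy; rewrite -ler_sqr ?nnegrE ?cmod_ge0 ?mulr_ge0 ?hnorm_ge0//.
by rewrite exprMn !hnorm2// cmod2 cauchy_schwarz_sq.
Qed.

Lemma hnorm_linear_le (a : C) x y : H x -> H y ->
  hnorm ip (a *: x + y) <= cmod a * hnorm ip x + hnorm ip y.
Proof.
move=> hx hy; have hxy := pip_lin hip a hx hy.
rewrite -ler_sqr ?nnegrE ?hnorm_ge0 ?addr_ge0 ?mulr_ge0 ?hnorm_ge0 ?cmod_ge0//.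
rewrite hnorm2// pip_expand// sqrrD exprMn !hnorm2// cmod2.
rewrite lerD2r lerD2l -[leRHS]mulr_natl ler_wpM2l//.
apply: le_trans (ler_norm _) _; apply: le_trans (cRe_le_cmod _) _.
by rewrite cmodM -mulrA ler_wpM2l ?cmod_ge0// cauchy_schwarz.
Qed.

End PreInnerProduct.

(** * Contractive multipliers *)

Section Multiplier.
Variables (R : realType) (d : nat).
Local Notation C := (Cplx R).
Variables (H2 : rkhs (@DAkernel R d)) (b : 'rV[C]_d -> C).
Hypothesis hb : contractive_multiplier H2 b.
Hypothesis hbc : ~ unimodular_constant b.
Local Notation ip := (rk_ip H2).
Local Notation H := (rk_space H2).

Lemma hilbert_subspace_pip (V : lmodType C) (W : set V) p :
  hilbert_subspace W p -> pre_inner_product W p.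
Proof. by case=> *; split. Qed.

Let hip : pre_inner_product H ip := hilbert_subspace_pip (rk_hilbert H2).

Definition ball_point z (hz : @Bd R d z) : set_type (@Bd R d) := SigSub (mem_set hz).

Lemma Bd0 : @Bd R d 0.
Proof. by rewrite /Bd /= big1 ?ltr01// => j _; rewrite mxE normr0 expr0n. Qed.

Definition kern (w : set_type (@Bd R d)) : set_type (@Bd R d) -> C :=
  fun z => DAkernel z w.

Lemma kern_ip f w : H f -> ip f (kern w) = f w.
Proof. exact: rk_reproducing. Qed.

Lemma kern_mem w : H (kern w). Proof. exact: rk_kernel. Qed.

Lemma kern0 z : kern (ball_point Bd0) z = 1.
Proof.
rewrite /kern /DAkernel /rdot big1 ?subr0 ?invr1// => j _.
by rewrite mxE conjC0 mulr0.
Qed.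

(** The adjoint of multiplication by [b] sends the kernel function at [w] to
    [b(w)^*] times itself, so [h] is the image of [f] under that contraction.
    Concretely [<b h, f> = <h, h>] by the reproducing property, and
    [0 <= |b h - f|^2] then bounds [|h|] because [|b h| <= |h|]. *)
Lemma adjoint_multiplier_le (s y : C) (v w : set_type (@Bd R d)) :
  let f := s *: kern v + y *: kern w in
  let h := (s * (b (val v))^*) *: kern v + (y * (b (val w))^*) *: kern w in
  (cRe (ip h h) <= cRe (ip f f))%R : Prop.
Proof.
move=> f h.
have hk (a c : C) : H (a *: kern v + c *: kern w).
  by apply: (pip_lin hip); [exact: kern_mem|apply: (pip_scale hip); exact: kern_mem].
have hf : H f := hk _ _.
have hh : H h := hk _ _.
have [hbh nbh] := hb.2 _ hh.
set bh := fun z => _ in hbh nbh.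
have ipk (a c : C) g : H g -> ip g (a *: kern v + c *: kern w) = a^* * g v + c^* * g w.
  move=> hg; rewrite (pip_linr hip) ?(pip_scaler hip) ?kern_ip//;
    by [exact: kern_mem|apply: (pip_scale hip); exact: kern_mem].
have e : ip bh f = ip h h.
  by rewrite !ipk// /bh !rmorphM /= !conjCK !mulrA.
have q1 : cRe (ip bh bh) <= cRe (ip h h).
  by rewrite -!(hnorm2 hip)// ler_sqr ?nnegrE ?hnorm_ge0.
have := pip_self_ge0 hip (pip_lin hip (-1) hbh hf).
rewrite (pip_expand hip)// e /absq cReN cImN cRe1 cIm1 mulN1r cReN.
lra.
Qed.

(** This is positivity of the matrix of [(1 - b(z) b(w)^* ) k(z, w)] at the two
    points [0] and [z]. *)
Lemma two_point_pick z (hz : Bd z) :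
  absq (1 - (b 0)^* * b z) <=
  (1 - absq (b 0)) * ((1 - absq (b z)) * cRe (kern (ball_point hz) (ball_point hz))) /\
  0 <= (1 - absq (b z)) * cRe (kern (ball_point hz) (ball_point hz)) /\
  0 <= 1 - absq (b 0).
Proof.
set k := cRe _; set c := 1 - _.
pose v := ball_point Bd0; pose w := ball_point hz.
have kv : ip (kern v) (kern v) = 1 by rewrite kern_ip ?kern0//; exact: kern_mem.
have kvw : ip (kern v) (kern w) = 1 by rewrite kern_ip ?kern0//; exact: kern_mem.
have kw : cRe (ip (kern w) (kern w)) = k by rewrite kern_ip//; exact: kern_mem.
have P (s y : C) : 0 <= absq s * (1 - absq (b 0)) +
    2 * cRe (s * (y^* * c)) + absq y * ((1 - absq (b z)) * k).
  have /= := adjoint_multiplier_le s y v w.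
  have hy (a : C) : H (a *: kern w) by apply: (pip_scale hip); exact: kern_mem.
  rewrite !(pip_expand hip) ?(pip_scale_self hip); try exact: kern_mem; try exact: hy.
  rewrite !(pip_scaler hip) ?kv ?kvw ?kw; try exact: kern_mem.
  rewrite /c /= !absqM /absq.
  rewrite !(cReD, cImD, cReN, cImN, cReM, cImM, cReC, cImC, cRe1, cIm1).
  lra.
split; last split.
- rewrite mulrC; apply: discriminant_le.
  + exact: absq_ge0.
  + by have := P 1 0; rewrite /absq !cplxE; lra.
  + move=> t; have := P (mkC (- t) 0 * c^*) 1.
    congr (_ <= _); rewrite absqM !/absq !cplxE.
    ring.
- by have := P 0 1; rewrite /absq !cplxE; lra.
- by have := P 1 0; rewrite /absq !cplxE; lra.
Qed.

(** Cauchy-Schwarz against the kernel function at [0], which is constant [1]. *)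
Lemma kern_diag_ge1 z (hz : Bd z) : 1 <= cRe (kern (ball_point hz) (ball_point hz)).
Proof.
have := cauchy_schwarz_sq hip (kern_mem (ball_point Bd0)) (kern_mem (ball_point hz)).
rewrite !kern_ip; try exact: kern_mem.
by rewrite !kern0 /absq cRe1 cIm1 expr1n expr0n /= addr0 mul1r.
Qed.

(** A value of modulus one makes a diagonal entry of the two-point matrix
    vanish, hence also the off-diagonal entry [1 - b(0)^* b(z)]. *)
Theorem contractive_multiplier_lt1 z : Bd z -> absq (b z) < 1.
Proof.
have b0 : absq (b 0) < 1.
  rewrite ltNge; apply/negP => h1; apply: hbc; exists (b 0).
    have [_ [_ h2]] := two_point_pick Bd0.
    have e : absq (b 0) = 1 by apply/eqP; rewrite eq_le h1 andbT; lra.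
    by rewrite cnormE /cmod e sqrtr1.
  move=> t ht; have [+ [_ h2]] := two_point_pick ht.
  have e : absq (b 0) = 1 by apply/eqP; rewrite eq_le h1 andbT; lra.
  rewrite e subrr mul0r => h3.
  have : 1 - (b 0)^* * b t = 0.
    by apply: absq_eq0; apply/eqP; rewrite eq_le h3 absq_ge0.
  move=> /subr0_eq /(congr1 (fun x => b 0 * x)).
  by rewrite mulr1 mulrA mulCJ e mul1r.
move=> hz; have [+ [+ _]] := two_point_pick hz.
set k := cRe _ => h1 h2.
rewrite ltNge; apply/negP => h3.
have k1 : 1 <= k := kern_diag_ge1 hz.
have e0 : (1 - absq (b z)) * k = 0.
  apply/eqP; rewrite eq_le h2 andbT; apply: mulr_le0_ge0; lra.
move: h1; rewrite e0 mulr0 => h1.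
have : 1 - (b 0)^* * b z = 0.
  by apply: absq_eq0; apply/eqP; rewrite eq_le h1 absq_ge0.
move=> /subr0_eq /(congr1 (@absq R)); rewrite absqM /absq cRe1 cIm1 cReC cImC.
rewrite sqrrN -!/(absq _) expr1n expr0n /= addr0 => e1.
have bz : absq (b z) = 1.
  move/eqP: e0; rewrite mulf_eq0 => /orP[]/eqP; lra.
move: e1; rewrite bz mulr1; lra.
Qed.
End Multiplier.

(** * Words and the sequence space *)

Section SequenceSpace.
Variables (R : realType) (d : nat).
Local Notation C := (Cplx R).
Local Notation word := (word d).
Local Notation ell2 := (ell2 R d).

(** A duplicate-free list of the words shorter than [n]: both the partial sums in
    [dotp] and those in [\esum] are compared through it, up to permutation. *)
Definition words (n : nat) : seq word :=
  flatten [seq [seq tval w | w <- enum {: k.-tuple 'I_d}] | k <- iota 0 n].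

Lemma mem_words n w : (w \in words n) = (size w < n)%N.
Proof.
apply/flatten_mapP/idP => [[k]|wn].
  by rewrite mem_iota add0n => kn /mapP[v _ ->]; rewrite size_tuple.
exists (size w); first by rewrite mem_iota.
by apply/mapP; exists (in_tuple w); rewrite ?mem_enum.
Qed.

Lemma big_words (V : nmodType) n (F : word -> V) :
  \sum_(w <- words n) F w = \sum_(k < n) \sum_(w : k.-tuple 'I_d) F w.
Proof.
rewrite big_flatten /= big_map -(big_mkord xpredT (fun k => \sum_(w : k.-tuple 'I_d) F w)).
rewrite /index_iota subn0; apply: eq_bigr => k _.
by rewrite big_map big_enum.
Qed.

Lemma words_uniq n : uniq (words n).
Proof.
elim: n => // n IH; rewrite /words -addn1 iotaD map_cat flatten_cat cat_uniq.
rewrite -/(words n) IH /= add0n cats0 map_inj_uniq ?enum_uniq ?andbT; last exact: val_inj.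
apply/hasPn => _ /mapP[v _ ->].
by apply/negP; rewrite -[_ \in _]/(_ \in words n) mem_words size_tuple ltnn.
Qed.

(** Splitting off the first letter turns the creation operators into shifts of
    the summation. *)
Lemma big_words_cons (V : nmodType) n (F : word -> V) :
  \sum_(w <- words n.+1) F w = F [::] + \sum_(j < d) \sum_(w <- words n) F (j :: w).
Proof.
rewrite (perm_big ([::] :: [seq j :: v | j <- enum 'I_d, v <- words n])).
  rewrite big_cons big_allpairs_dep /= big_enum /=; congr (_ + _).
apply: uniq_perm; first exact: words_uniq.
  rewrite /=; apply/andP; split; first by apply/negP => /allpairsP[[? ?] []].
  apply: allpairs_uniq; rewrite ?enum_uniq ?words_uniq//.
  by move=> [i u] [j v] _ _ /= e; case: e => e1 e2; rewrite e1 e2.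
move=> [|j v]; rewrite mem_words in_cons /=; first by [].
rewrite ltnS -mem_words; apply/idP/allpairsP => [vn|[[i u] [_ /= un e]]].
  by exists (j, v); rewrite mem_enum.
by case: e => _ ->.
Qed.

Lemma ler_sum_subseq (s t : seq word) (F : word -> R) : uniq s ->
  {subset s <= t} -> uniq t -> (forall w, 0 <= F w) ->
  \sum_(w <- s) F w <= \sum_(w <- t) F w.
Proof.
move=> us st ut F0; rewrite [leRHS](bigID (mem s)) /= -[leLHS]addr0.
rewrite lerD ?sumr_ge0// -[leRHS]big_filter (perm_big [seq w <- t | w \in s])//.
apply: uniq_perm => //; first exact: filter_uniq.
by move=> w; rewrite mem_filter; case: (boolP (w \in s)) => //= /st ->.
Qed.

Lemma big_words_pick (V : nmodType) n (F : word -> V) v :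
  \sum_(w <- words n | w == v) F w = if (size v < n)%N then F v else 0.
Proof.
rewrite -big_filter -mem_words; case: ifPn => [vn|/negP vn].
  by rewrite filter_pred1_uniq ?words_uniq// big_seq1.
by rewrite big_filter big_seq_cond big1// => w /andP[h /eqP e]; case: vn; rewrite -e.
Qed.

Definition sqsum (n : nat) (x : word -> C) : R := \sum_(w <- words n) absq (x w).

Lemma sqsum_ge0 n x : 0 <= sqsum n x.
Proof. by apply: sumr_ge0 => w _; exact: absq_ge0. Qed.

Lemma sqsum_le x m n : (m <= n)%N -> sqsum m x <= sqsum n x.
Proof.
move=> mn; apply: ler_sum_subseq; rewrite ?words_uniq//; last by move=> w; exact: absq_ge0.
move=> w.
by rewrite !mem_words => /leq_trans; apply.
Qed.

Lemma square_summableP (x : word -> C) :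
  x \in @square_summable R d <-> exists M, forall n, sqsum n x <= M.
Proof.
split => [/asboolP sx|[M hM]].
  move: sx; set e := esum _ _ => fe.
  have h n : ((sqsum n x)%:E <= e)%E.
    rewrite /sqsum -sumEFin fsbig_seq ?words_uniq//.
    apply: ereal_sup_ubound; exists [set` words n] => //.
    by split => //; exact: finite_seq.
  have e0 : (0 <= e)%E := le_trans (_ : (0 <= (sqsum 0 x)%:E)%E) (h 0).
  exists (fine e) => n; rewrite -lee_fin fineK//.
  by rewrite ge0_fin_numE// e0// lee_fin sqsum_ge0.
apply/asboolP; apply: (@le_lt_trans _ _ M%:E); last exact: ltry.
apply: ge_ereal_sup => _ [F [finF _] <-].
have [s ->] := (finite_seqP F).1 finF.
have -> : [set` s] = [set` undup s].
  by apply/seteqP; split => w /=; rewrite mem_undup.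
rewrite -fsbig_seq ?undup_uniq// sumEFin lee_fin.
apply: le_trans (hM (\max_(w <- undup s) size w).+1).
apply: ler_sum_subseq; rewrite ?undup_uniq ?words_uniq//; last by move=> w; exact: absq_ge0.
by move=> w ws; rewrite mem_words ltnS; exact: leq_bigmax_seq.
Qed.

Lemma ell2D (x y : ell2) w : (x + y) w = x w + y w. Proof. by []. Qed.
Lemma ell2Z (a : C) (x : ell2) w : (a *: x) w = a * x w. Proof. by []. Qed.
Lemma ell2N (x : ell2) w : (- x) w = - x w. Proof. by []. Qed.
Lemma ell20 w : (0 : ell2) w = 0. Proof. by []. Qed.
Lemma ell2_sum I (r : seq I) (P : pred I) (F : I -> ell2) w :
  (\sum_(i <- r | P i) F i) w = \sum_(i <- r | P i) F i w.
Proof. exact: (big_morph (fun x : ell2 => x w) (fun x y => ell2D x y w) (ell20 w)). Qed.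
Lemma ell2P (x y : ell2) : (forall w, x w = y w) -> x = y.
Proof. by move=> h; apply/val_inj/funext. Qed.

Lemma sqsum_bounded (x : ell2) : exists M, forall n, sqsum n x <= M.
Proof. by apply/square_summableP; case: x. Qed.

Lemma sqsum_cvg (x : ell2) : (sqsum ^~ x) @ \oo --> limn (sqsum ^~ x).
Proof.
apply: nondecreasing_is_cvgn; first by move=> m n; exact: sqsum_le.
by have [M h] := sqsum_bounded x; exists M => _ [n _ <-].
Qed.

Definition dotsum (n : nat) (x y : word -> C) : C := \sum_(w <- words n) x w * (y w)^*.

Lemma sqsumE n x : sqsum n x = cRe (dotsum n x x).
Proof. by rewrite /dotsum cRe_sum; apply: eq_bigr => w _; rewrite mulCJ. Qed.

Lemma dotsum_linl n (a : C) x y z :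
  dotsum n (fun w => a * x w + y w) z = a * dotsum n x z + dotsum n y z.
Proof.
rewrite /dotsum mulr_sumr -big_split; apply: eq_bigr => w _ /=.
by rewrite mulrDl mulrA.
Qed.

Lemma dotsum_sym n x y : dotsum n y x = (dotsum n x y)^*.
Proof.
rewrite /dotsum rmorph_sum; apply: eq_bigr => w _ /=.
by rewrite rmorphM /= conjCK mulrC.
Qed.

Lemma cRe_dotsum n x y :
  cRe (dotsum n x y) = (sqsum n (fun w => x w + y w) - sqsum n x - sqsum n y) / 2.
Proof.
rewrite /dotsum cRe_sum /sqsum -!sumrB mulr_suml; apply: eq_bigr => w _.
by rewrite /absq !(cReD, cImD, cReM, cReC, cImC); field.
Qed.

Lemma cIm_dotsum n x y :
  cIm (dotsum n x y) = (sqsum n (fun w => x w + mkC 0 1 * y w) - sqsum n x - sqsum n y) / 2.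
Proof.
rewrite /dotsum cIm_sum /sqsum -!sumrB mulr_suml; apply: eq_bigr => w _.
by rewrite /absq !(cReD, cImD, cReM, cImM, cReC, cImC, cRemk, cImmk); field.
Qed.

(** By polarization the partial sums of the inner product are combinations of
    partial sums of squares, which are monotone and bounded. *)
Lemma dotp_cvg (x y : ell2) : (fun n => dotsum n x y) @ \oo --> dotp x y.
Proof.
have [l hl] : exists l : C, (fun n => dotsum n x y) @ \oo --> l.
  pose L (z : ell2) := limn (sqsum ^~ z).
  exists (mkC ((L (x + y) - L x - L y) / 2) ((L (x + mkC 0 1 *: y) - L x - L y) / 2)).
  apply/cvg_cplxP; rewrite cRemk cImmk; split.
    under eq_fun do rewrite cRe_dotsum.
    by apply: cvgMr_tmp; apply: cvgB; first apply: cvgB; exact: sqsum_cvg.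
  under eq_fun do rewrite cIm_dotsum.
  by apply: cvgMr_tmp; apply: cvgB; first apply: cvgB; exact: sqsum_cvg.
rewrite /dotp (_ : (fun n => _) = (fun n => dotsum n x y)); last first.
  by apply/funext => n; rewrite /dotsum big_words.
by rewrite (cvg_lim _ hl)//; exact: norm_hausdorff.
Qed.

Lemma dotp_unique (x y : ell2) (l : C) :
  (fun n => dotsum n x y) @ \oo --> l -> dotp x y = l.
Proof.
move=> hl; have hh : hausdorff_space C by exact: norm_hausdorff.
by rewrite -(cvg_lim hh hl) (cvg_lim hh (@dotp_cvg x y)).
Qed.

Lemma conjC_cvg (u : nat -> C) l : u @ \oo --> l -> (fun n => (u n)^*) @ \oo --> l^*.
Proof.
move=> /cvg_cplxP[h k]; apply/cvg_cplxP; rewrite cReC cImC; split.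
  by under eq_fun do rewrite cReC.
by under eq_fun do rewrite cImC; apply: cvgN.
Qed.

Lemma dotp_pip : pre_inner_product [set: ell2] (@dotp R d).
Proof.
split => //.
- move=> a x y z _ _ _; apply: dotp_unique.
  rewrite (_ : (fun n => _) = (fun n => a * dotsum n x z + dotsum n y z)); last first.
    by apply/funext => n; rewrite -dotsum_linl.
  apply: cvgD; last exact: dotp_cvg.
  by apply: cvgMl_tmp; exact: dotp_cvg.
- move=> x y _ _; apply: dotp_unique; under eq_fun do rewrite dotsum_sym.
  exact/conjC_cvg/dotp_cvg.
- move=> x _; have /cvg_cplxP[h k] := @dotp_cvg x x.
  rewrite cleE; apply/andP; split.
    apply/eqP; rewrite cIm0 -(cvg_lim (@Rhausdorff R) k).
    rewrite (_ : (fun _ => _) = fun=> 0) ?lim_cst//.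
    apply/funext => n; rewrite /dotsum cIm_sum big1// => w _.
    by rewrite mulCJ cImmk.
  apply: (cvgr_to_ge h); apply: nearW => n.
  by rewrite -sqsumE sqsum_ge0.
Qed.

Local Notation hn := (hnorm (@dotp R d)).

Lemma sqsum_hnorm (x : ell2) : (sqsum ^~ x) @ \oo --> hn x ^+ 2.
Proof.
rewrite (hnorm2 dotp_pip)//.
by have /cvg_cplxP[h _] := @dotp_cvg x x; under eq_fun do rewrite sqsumE.
Qed.

Lemma sqsum_le_hnorm (x : ell2) n : sqsum n x <= hn x ^+ 2.
Proof.
apply: (cvgr_to_ge (@sqsum_hnorm x)); exists n => // m /= nm; exact: sqsum_le.
Qed.

Lemma hnorm_le_sqsum (x : ell2) M : 0 <= M ->
  (forall n, sqsum n x <= M ^+ 2) -> hn x <= M.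
Proof.
move=> M0 h; rewrite -ler_sqr ?nnegrE ?hnorm_ge0//.
by apply: (cvgr_to_le (@sqsum_hnorm x)); apply: nearW => n; exact: h.
Qed.

Lemma absq_le_hnorm (x : ell2) w : absq (x w) <= hn x ^+ 2.
Proof.
apply: le_trans (sqsum_le_hnorm x (size w).+1).
have -> : absq (x w) = \sum_(v <- words (size w).+1 | v == w) absq (x v).
  by rewrite big_words_pick ltnSn.
by rewrite /sqsum [leRHS](bigID (pred1 w)) /= lerDl sumr_ge0// => v _; exact: absq_ge0.
Qed.

Lemma cmod_le_hnorm (x : ell2) w : cmod (x w) <= hn x.
Proof.
by rewrite -ler_sqr ?nnegrE ?hnorm_ge0 ?cmod_ge0// cmod2 absq_le_hnorm.
Qed.

Lemma hnorm_eq0 (x : ell2) : hn x = 0 -> x = 0.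
Proof.
move=> h; apply: ell2P => w; apply: cmod_eq0; apply/eqP.
by rewrite eq_le cmod_ge0 andbT -h cmod_le_hnorm.
Qed.

Lemma dotp_linl (a : C) (x y z : ell2) : dotp (a *: x + y) z = a * dotp x z + dotp y z.
Proof. exact: (pip_ip_lin dotp_pip). Qed.
Lemma dotp_linr (a : C) (x y z : ell2) : dotp z (a *: x + y) = a^* * dotp z x + dotp z y.
Proof. exact: (pip_linr dotp_pip). Qed.
Lemma dotp_sym (x y : ell2) : dotp y x = (dotp x y)^*.
Proof. exact: (pip_ip_sym dotp_pip). Qed.
Lemma dotp0r (x : ell2) : dotp x 0 = 0. Proof. exact: (pip_0r dotp_pip). Qed.
Lemma dotp0l (x : ell2) : dotp 0 x = 0.
Proof. by rewrite dotp_sym dotp0r conjC0. Qed.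
Lemma dotpDl (x y z : ell2) : dotp (x + y) z = dotp x z + dotp y z.
Proof. by rewrite -[x in LHS]scale1r dotp_linl mul1r. Qed.
Lemma dotpZl (a : C) (x z : ell2) : dotp (a *: x) z = a * dotp x z.
Proof. by rewrite -[_ *: _]addr0 dotp_linl dotp0l addr0. Qed.
Lemma dotpBl (x y z : ell2) : dotp (x - y) z = dotp x z - dotp y z.
Proof. by rewrite dotpDl -scaleN1r dotpZl mulN1r. Qed.
Lemma dotp_CS (x y : ell2) : cmod (dotp x y) <= hn x * hn y.
Proof. exact: (cauchy_schwarz dotp_pip). Qed.
Lemma hnorm_add (x y : ell2) : hn (x + y) <= hn x + hn y.
Proof.
have := @hnorm_linear_le _ _ _ _ dotp_pip 1 x y I I.
by rewrite scale1r cmod1 mul1r.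
Qed.
Lemma hnorm_scale (a : C) (x : ell2) : hn (a *: x) = cmod a * hn x.
Proof.
rewrite /hnorm (pip_scale_self dotp_pip)// sqrtrM ?absq_ge0//.
Qed.
Lemma hnorm_opp (x : ell2) : hn (- x) = hn x.
Proof. by rewrite -scaleN1r hnorm_scale cmodN cmod1 mul1r. Qed.
Lemma hnorm_zero : hn (0 : ell2) = 0.
Proof. by rewrite -(scale0r 0) hnorm_scale cmod0 mul0r. Qed.
Lemma hnorm_sum I (r : seq I) (P : pred I) (F : I -> ell2) :
  hn (\sum_(i <- r | P i) F i) <= \sum_(i <- r | P i) hn (F i).
Proof.
elim/big_ind2: _ => [|a x b y h k|//]; first by rewrite hnorm_zero.
exact: le_trans (hnorm_add _ _) (lerD h k).
Qed.
Lemma dotp_self (x : ell2) : dotp x x = mkC (hn x ^+ 2) 0.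
Proof. by rewrite (hnorm2 dotp_pip)// -(pip_self dotp_pip). Qed.

(** * Coordinates *)

Lemma dotp_xi (x : ell2) v : dotp x (xi R v) = x v.
Proof.
apply: dotp_unique; apply: (@cvg_near_cst); exists (size v).+1 => // n /= vn.
rewrite /dotsum (bigID (pred1 v)) /= big_words_pick vn /dirac_fun eqxx conjC1 mulr1.
by rewrite big1 ?addr0// => w /negbTE ->; rewrite conjC0 mulr0.
Qed.

Lemma hnorm_xi v : hn (xi R v) = 1.
Proof. by rewrite /hnorm dotp_xi /= /dirac_fun eqxx cRe1 sqrtr1. Qed.

Definition trunc n (x : word -> C) : ell2 := \sum_(w <- words n) x w *: xi R w.

Lemma truncE n x v : trunc n x v = if (size v < n)%N then x v else 0.
Proof.
rewrite /trunc ell2_sum (eq_bigr (fun w => x w * (v == w)%:R))//.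
rewrite (bigID (pred1 v)) /= big_words_pick eqxx mulr1.
by rewrite big1 ?addr0// => w; rewrite eq_sym => /negbTE ->; rewrite mulr0.
Qed.

Lemma sqsum_trunc m n (x : word -> C) : sqsum m (trunc n x) = sqsum (minn m n) x.
Proof.
have E w : absq (trunc n x w) = if (size w < n)%N then absq (x w) else 0.
  by rewrite truncE; case: ifP => // _; rewrite absq0.
rewrite /sqsum (eq_bigr _ (fun w _ => E w)) -big_mkcond /=.
rewrite -big_filter; apply: perm_big; apply: uniq_perm.
- exact/filter_uniq/words_uniq.
- exact: words_uniq.
- by move=> w; rewrite mem_filter !mem_words ltn_min andbC.
Qed.

Lemma hnorm_trunc n (x : word -> C) : hn (trunc n x) ^+ 2 = sqsum n x.
Proof.
have hR := @Rhausdorff R; rewrite -(cvg_lim hR (@sqsum_hnorm (trunc n x))).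
apply: cvg_lim => //; apply: (@cvg_near_cst); exists n => // m /= nm.
by rewrite sqsum_trunc (minn_idPr nm).
Qed.

(** Truncation removes the first [n] layers, so the squared distance to [x] is
    at most the tail of the series of squares. *)
Lemma trunc_cvg (x : ell2) : (fun n => hn (x - trunc n x)) @ \oo --> (0 : R).
Proof.
have h n : hn (x - trunc n x) <= Num.sqrt (hn x ^+ 2 - sqsum n x).
  apply: hnorm_le_sqsum => [|m]; first exact: sqrtr_ge0.
  rewrite sqr_sqrtr ?subr_ge0 ?sqsum_le_hnorm//.
  have -> : sqsum m (x - trunc n x)%R = sqsum m x - sqsum (minn m n) x.
    rewrite -sqsum_trunc /sqsum -sumrB; apply: eq_bigr => w _.
    by rewrite ell2D ell2N truncE; case: ifP => _; rewrite ?subrr ?absq0 ?subr0.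
  rewrite /minn; case: ltnP => [mn|nm]; last by rewrite lerD2r sqsum_le_hnorm.
  by rewrite subrr subr_ge0 sqsum_le_hnorm.
apply: (squeeze_cvgr (f := fun=> 0) (h := fun n => Num.sqrt (hn x ^+ 2 - sqsum n x))).
- by apply: nearW => n; rewrite hnorm_ge0 h.
- exact: cvg_cst.
- rewrite -[X in _ --> X]sqrtr0 -(subrr (hn x ^+ 2)).
  apply: (continuous_cvg _ (@sqrt_continuous R _)).
  by apply: cvgB; [exact: cvg_cst|exact: sqsum_hnorm].
Qed.

(** The limit is taken coordinatewise. On finitely many coordinates the bound
    passes to the limit, and the finite sums control the norm. *)
Lemma ell2_complete (u : nat -> ell2) (e : nat -> R) : e @ \oo --> (0 : R) ->
  (forall m n, (m <= n)%N -> hn (u n - u m) <= e m) ->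
  exists x : ell2, forall n, hn (x - u n) <= e n.
Proof.
move=> e0 he.
have e_ge0 m : 0 <= e m by apply: le_trans (he m m (leqnn _)); exact: hnorm_ge0.
have cauchyR (v : nat -> R) : (forall m n, (m <= n)%N -> `|v n - v m| <= e m) ->
    v @ \oo --> limn v.
  move=> hv; apply/cauchy_cvgP; apply/cauchy_exP => r r0.
  have /cvgrPdist_lt/(_ r r0)[N _ hN] := e0.
  exists (v N); exists N => // n /= Nn.
  rewrite /ball /= distrC; apply: le_lt_trans (hv _ _ Nn) _.
  by have := hN N (leqnn _); rewrite /= sub0r normrN ger0_norm.
pose x w : C := mkC (limn (fun n => cRe (u n w))) (limn (fun n => cIm (u n w))).
have xP w : (fun n => u n w) @ \oo --> x w.
  apply/cvg_cplxP; rewrite cRemk cImmk; split; apply: cauchyR => m n mn.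
    rewrite -cReN -cReD; apply: le_trans (cRe_le_cmod _) _.
    by apply: le_trans (he _ _ mn); exact: (cmod_le_hnorm (u n - u m)).
  rewrite -cImN -cImD; apply: le_trans (cIm_le_cmod _) _.
  by apply: le_trans (he _ _ mn); exact: (cmod_le_hnorm (u n - u m)).
(* The bound by [e n] survives the coordinatewise limit in [m]. *)
have key k n : sqsum k (fun w => x w - u n w) <= e n ^+ 2.
  have : (fun m => sqsum k (u m - u n : ell2)%R) @ \oo --> sqsum k (fun w => x w - u n w).
    rewrite /sqsum; apply: (cvg_big (op := +%R)) => [|w _]; first exact: add_continuous.
    rewrite /absq.
    have /cvg_cplxP[h1 h2] := xP w.
    rewrite !(cReD, cImD, cReN, cImN).
    under eq_fun do rewrite !(cReD, cImD, cReN, cImN).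
    by apply: cvgD; apply: cvgM; apply: cvgB => //; exact: cvg_cst.
  move=> hc; apply: (cvgr_to_le hc); exists n => // m /= nm.
  apply: le_trans (sqsum_le_hnorm (u m - u n) k) _.
  by rewrite ler_sqr ?nnegrE ?hnorm_ge0// he.
have sx : (fun w => x w - u 0%N w) \in @square_summable R d.
  by apply/square_summableP; exists (e 0%N ^+ 2).
exists (Ell2 sx + u 0%N) => n; apply: hnorm_le_sqsum => // k.
apply: le_trans (key k n); rewrite le_eqVlt; apply/orP; left; apply/eqP.
by apply: eq_bigr => w _; rewrite ell2D ell2D ell2N /= subrK.
Qed.

End SequenceSpace.

(** * Bounded operators and their adjoints *)

Section Operators.
Variables (R : realType) (d : nat).
Local Notation C := (Cplx R).
Local Notation word := (word d).
Local Notation ell2 := (ell2 R d).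
Local Notation op := (op R d).
Local Notation hn := (hnorm (@dotp R d)).

Implicit Types T U V : op.

Definition lin (T : op) : Prop := forall (a : C) x y, T (a *: x + y) = a *: T x + T y.
Definition op_bound (T : op) (M : R) : Prop := forall x, hn (T x) <= M * hn x.

Lemma lin0 T : lin T -> T 0 = 0.
Proof. by move=> h; have := h (-1) 0 0; rewrite scaler0 addr0 scaleN1r addNr. Qed.
Lemma linD T x y : lin T -> T (x + y) = T x + T y.
Proof. by move=> h; have := h 1 x y; rewrite !scale1r. Qed.
Lemma linZ T a x : lin T -> T (a *: x) = a *: T x.
Proof. by move=> h; have := h a x 0; rewrite (lin0 h) !addr0. Qed.
Lemma linB T x y : lin T -> T (x - y) = T x - T y.
Proof. by move=> h; rewrite -scaleN1r (linD _ _ h) (linZ _ _ h) scaleN1r. Qed.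
Lemma lin_sum T I (r : seq I) (P : pred I) (F : I -> ell2) : lin T ->
  T (\sum_(i <- r | P i) F i) = \sum_(i <- r | P i) T (F i).
Proof. by move=> h; apply: (big_morph T _ (lin0 h)) => x y; exact: linD. Qed.

Lemma opD (T U : op) x : (T + U) x = T x + U x. Proof. by []. Qed.
Lemma opB (T U : op) x : (T - U) x = T x - U x. Proof. by []. Qed.
Lemma opZ (a : C) (T : op) x : (a *: T) x = a *: T x. Proof. by []. Qed.
Lemma op_sum I (r : seq I) (P : pred I) (F : I -> op) x :
  (\sum_(i <- r | P i) F i) x = \sum_(i <- r | P i) F i x.
Proof. exact: (big_morph (fun T : op => T x)). Qed.

Lemma lin_id : lin id. Proof. by []. Qed.
Lemma lin_comb (a : C) T U : lin T -> lin U -> lin (a *: T + U).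
Proof.
move=> hT hU c x y; rewrite !(opD, opZ) hT hU !scalerDr !scalerA (mulrC a c).
by rewrite addrACA.
Qed.
Lemma lin_comp T U : lin T -> lin U -> lin (T \o U).
Proof. by move=> hT hU c x y /=; rewrite hU hT. Qed.

Lemma op_bound_comb (a : C) T U M N : op_bound T M -> op_bound U N ->
  op_bound (a *: T + U) (cmod a * M + N).
Proof.
move=> hT hU x; rewrite opD opZ. apply: le_trans (hnorm_add _ _) _.
by rewrite hnorm_scale mulrDl -mulrA lerD// ler_wpM2l ?cmod_ge0.
Qed.
Lemma op_bound_comp T U M N : 0 <= M -> op_bound T M -> op_bound U N -> op_bound (T \o U) (M * N).
Proof.
by move=> M0 hT hU x; apply: (le_trans (hT (U x))); rewrite -mulrA ler_wpM2l.
Qed.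
Lemma op_bound_le T M N : M <= N -> op_bound T M -> op_bound T N.
Proof.
by move=> MN h x; apply: (le_trans (h x)); rewrite ler_wpM2r ?hnorm_ge0.
Qed.

Lemma op_bound_opnorm T M : 0 <= M -> op_bound T M -> (opnorm T <= M%:E)%E.
Proof.
move=> M0 h; apply: ge_ereal_sup => _ [x /= x1 <-]; rewrite lee_fin.
by apply: le_trans (h x) _; rewrite -[leRHS]mulr1 ler_wpM2l.
Qed.

Lemma opnorm_op_bound T e : lin T -> (opnorm T <= e%:E)%E -> op_bound T e.
Proof.
move=> hT hle x; have [x0|xn0] := eqVneq (hn x) 0.
  by rewrite x0 mulr0 (hnorm_eq0 x0) (lin0 hT) hnorm_zero.
have xp : 0 < hn x by rewrite lt_def xn0 hnorm_ge0.
have cm : cmod (mkC (hn x)^-1 0) = (hn x)^-1.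
  by rewrite cmod_real ger0_norm// invr_ge0 ltW.
have : ((hn (T (mkC (hn x)^-1 0 *: x)))%:E <= e%:E)%E.
  apply: le_trans hle; apply: ereal_sup_ubound; exists (mkC (hn x)^-1 0 *: x) => //=.
  by rewrite hnorm_scale cm mulVf.
by rewrite lee_fin linZ// hnorm_scale cm mulrC ler_pdivrMr.
Qed.

Lemma bounded_opP T : bounded_op T <-> lin T /\ exists2 M, 0 <= M & op_bound T M.
Proof.
split=> [[hT hf]|[hT [M M0 hM]]]; last first.
  split=> //; apply: le_lt_trans (ltry M); exact: op_bound_opnorm.
split=> //; have h0 : (0 <= opnorm T)%E.
  apply: ereal_sup_ubound; exists 0; rewrite /= ?hnorm_zero ?ler01//.
  by rewrite (lin0 hT) hnorm_zero.
exists (fine (opnorm T)); first exact: fine_ge0.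
apply: opnorm_op_bound => //; rewrite fineK//.
by rewrite ge0_fin_numE.
Qed.

Lemma bounded_lin T : bounded_op T -> lin T. Proof. by case. Qed.

Lemma bounded_id : bounded_op (id : op).
Proof.
by apply/bounded_opP; split => //; exists 1 => // x; rewrite mul1r.
Qed.

Lemma bounded_comb (a : C) (T U : op) : bounded_op T -> bounded_op U ->
  bounded_op (a *: T + U : op)%R.
Proof.
move=> /bounded_opP[hT [M M0 hM]] /bounded_opP[hU [N N0 hN]].
apply/bounded_opP; split; first exact: lin_comb.
exists (cmod a * M + N); first by rewrite addr_ge0 ?mulr_ge0 ?cmod_ge0.
exact: op_bound_comb.
Qed.

Lemma bounded_0 : bounded_op (0 : op).
Proof.
apply/bounded_opP; split; first by move=> a x y; rewrite scaler0 addr0.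
by exists 0 => // x; rewrite hnorm_zero mul0r.
Qed.

Lemma bounded_comp T U : bounded_op T -> bounded_op U -> bounded_op (T \o U : op).
Proof.
move=> /bounded_opP[hT [M M0 hM]] /bounded_opP[hU [N N0 hN]].
apply/bounded_opP; split; first exact: lin_comp.
by exists (M * N); [rewrite mulr_ge0|exact: op_bound_comp].
Qed.

Lemma combE (T U : op) : (T - U)%R = (-1 : C) *: U + T.
Proof. by rewrite scaleN1r addrC. Qed.

Lemma lin_sub T U : lin T -> lin U -> lin (T - U : op)%R.
Proof. by move=> hT hU; rewrite combE; exact: lin_comb. Qed.

(** * Adjoints *)

Lemma dotp_eq_op (T U : op) : (forall x y, dotp x (T y) = dotp x (U y)) -> T = U.
Proof.
move=> h; apply/funext => y; apply: ell2P => w.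
by rewrite -!dotp_xi dotp_sym h -dotp_sym.
Qed.

Lemma is_adjoint_unique T U V : is_adjoint T U -> is_adjoint T V -> U = V.
Proof. by move=> [_ h] [_ k]; apply: dotp_eq_op => x y; rewrite -h k. Qed.

Lemma is_adjoint_sym T U : bounded_op T -> is_adjoint T U -> is_adjoint U T.
Proof. by move=> bT [bU h]; split=> // x y; rewrite dotp_sym -h -dotp_sym. Qed.

Lemma adj_eq T U : is_adjoint T U -> adj T = U.
Proof.
move=> h; rewrite /adj; case: xgetP => [V _ /= hV|/(_ U)]; last by [].
exact: is_adjoint_unique hV h.
Qed.

Lemma is_adjoint_comb (a : C) (T T' U U' : op) : is_adjoint T U -> is_adjoint T' U' ->
  is_adjoint (a *: T + T' : op)%R (a^* *: U + U' : op)%R.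
Proof.
move=> [bU h] [bU' h']; split; first exact: bounded_comb.
by move=> x y; rewrite !(opD, opZ) dotp_linl dotp_linr conjCK h h'.
Qed.

Lemma is_adjoint_0 : is_adjoint (0 : op) (0 : op).
Proof. by split; [exact: bounded_0|move=> x y; rewrite dotp0l dotp0r]. Qed.

Lemma is_adjoint_id : is_adjoint (id : op) id.
Proof. by split; [exact: bounded_id|]. Qed.

Lemma is_adjoint_comp T T' U U' : is_adjoint T U -> is_adjoint T' U' ->
  is_adjoint (T \o T' : op) (U' \o U : op).
Proof.
move=> [bU h] [bU' h']; split; first exact: bounded_comp.
by move=> x y /=; rewrite h h'.
Qed.

(** Divide [|U y|^2 = <T (U y), y> <= M |U y| |y|] by [|U y|]. *)
Lemma adjoint_op_bound T U M : 0 <= M -> is_adjoint T U -> op_bound T M -> op_bound U M.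
Proof.
move=> M0 [bU h] hM y; have [->|n0] := eqVneq (hn (U y)) 0.
  by rewrite mulr_ge0 ?hnorm_ge0.
have p : 0 < hn (U y) by rewrite lt_def n0 hnorm_ge0.
rewrite -(ler_pM2r p) -expr2.
have -> : hn (U y) ^+ 2 = cRe (dotp (T (U y)) y) by rewrite h dotp_self cRemk.
apply: le_trans (ler_norm _) _; apply: le_trans (cRe_le_cmod _) _.
apply: le_trans (dotp_CS _ _) _.
by rewrite mulrAC ler_wpM2r ?hnorm_ge0.
Qed.

(** The coordinates of [U y] have to be [<y, T xi_w>]. Testing [T] on the
    truncations of this family shows that it is square summable with norm at
    most [M |y|], and letting the truncations of [x] grow gives the adjoint
    relation. *)
Lemma adjoint_exists T : bounded_op T -> exists U, is_adjoint T U.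
Proof.
move=> /bounded_opP[hT [M M0 hM]].
pose f (y : ell2) : word -> C := fun w => dotp y (T (xi R w)).
have fE (y : ell2) n (x : word -> C) : dotp (T (trunc n x)) y = dotsum n x (f y).
  rewrite /trunc lin_sum// (big_morph (fun z => dotp z y) (fun u v => dotpDl u v y) (dotp0l y)).
  by apply: eq_bigr => w _; rewrite linZ// dotpZl /f -dotp_sym.
have pf (y : ell2) n : sqsum n (f y) <= (M * hn y) ^+ 2.
  have h : sqsum n (f y) <= M * hn (trunc n (f y)) * hn y.
    rewrite sqsumE -fE; apply: le_trans (ler_norm _) _.
    apply: le_trans (cRe_le_cmod _) _; apply: le_trans (dotp_CS _ _) _.
    by rewrite ler_wpM2r ?hnorm_ge0.
  rewrite -hnorm_trunc in h *; rewrite ler_sqr ?nnegrE ?mulr_ge0 ?hnorm_ge0//.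
  have [->|n0] := eqVneq (hn (trunc n (f y))) 0; first by rewrite mulr_ge0 ?hnorm_ge0.
  by rewrite mulrAC expr2 ler_pM2r// in h; rewrite lt_def n0 hnorm_ge0.
have sf (y : ell2) : f y \in @square_summable R d.
  by apply/square_summableP; exists ((M * hn y) ^+ 2).
pose U : op := fun y => Ell2 (sf y).
have hU x y : dotp (T x) y = dotp x (U y).
  apply/esym/dotp_unique; apply/cvg_cplxP.
  have hz : (fun n => M * hn (x - trunc n x) * hn y) @ \oo --> (M * 0 * hn y).
    by apply: cvgMr_tmp; apply: cvgMl_tmp; exact: trunc_cvg.
  rewrite mulr0 mul0r in hz.
  have hb n : cmod (dotsum n x (f y) - dotp (T x) y) <= M * hn (x - trunc n x) * hn y.
    rewrite -fE cmodBC -dotpBl -linB//.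
    apply: le_trans (dotp_CS _ _) _.
    by rewrite ler_wpM2r ?hnorm_ge0.
  split; apply/cvgrPdist_lt => e e0; move/cvgrPdist_lt/(_ e e0): hz;
    apply: filterS => n; rewrite sub0r normrN => /(le_lt_trans (ler_norm _));
    apply: le_lt_trans; apply: le_trans (hb n); rewrite distrC.
    by rewrite -cReN -cReD cRe_le_cmod.
  by rewrite -cImN -cImD cIm_le_cmod.
exists U; split=> //; apply/bounded_opP; split.
  move=> a y z; apply: ell2P => w.
  by rewrite ell2D ell2Z /= /f dotp_linl.
exists M => // y; apply: hnorm_le_sqsum; first by rewrite mulr_ge0 ?hnorm_ge0.
by move=> n; exact: pf.
Qed.

End Operators.

(** * The operator system and its states *)

Section OperatorSystem.
Variables (R : realType) (d : nat).
Local Notation C := (Cplx R).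
Local Notation word := (word d).
Local Notation ell2 := (ell2 R d).
Local Notation op := (op R d).
Local Notation hn := (hnorm (@dotp R d)).
Implicit Types (T U A B : op) (V : set op).

Definition op_subspace V : Prop := forall (a : C) T U, V T -> V U -> V (a *: T + U)%R.

(** Real bounds [op_bound] are easier to add and compose than the extended real
    operator norm; strictness is recovered by halving [e]. *)
Lemma opclosureP V T : V `<=` @bounded_op R d ->
  opclosure V T <-> bounded_op T /\
    forall e : R, 0 < e -> exists2 U, V U & op_bound (T - U)%R e.
Proof.
move=> VB; split=> -[bT h]; split=> // e e0.
  have [U VU /ltW hU] := h e e0; exists U => //.
  by apply: opnorm_op_bound => //; apply: lin_sub; apply: bounded_lin => //; exact: VB.
have e2 : 0 < e / 2 by rewrite divr_gt0.
have [U VU hU] := h _ e2; exists U => //.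
apply: le_lt_trans (op_bound_opnorm (ltW e2) hU) _.
by rewrite lte_fin ltr_pdivrMr// mulrDr mulr1 ltrDl.
Qed.

Lemma opclosure_bounded V : opclosure V `<=` @bounded_op R d.
Proof. by move=> T []. Qed.

Lemma sub_opclosure V : V `<=` @bounded_op R d -> V `<=` opclosure V.
Proof.
move=> VB T VT; apply/opclosureP => //; split; first exact: VB.
move=> e e0; exists T => // x; rewrite opB subrr hnorm_zero.
by rewrite mulr_ge0 ?hnorm_ge0// ltW.
Qed.

Lemma opclosure_lin V : V `<=` @bounded_op R d -> op_subspace V -> op_subspace (opclosure V).
Proof.
move=> VB Vl a T U /(opclosureP _ VB)[bT hT] /(opclosureP _ VB)[bU hU].
apply/(opclosureP _ VB); split; first exact: bounded_comb.
move=> e e0; pose e1 := e / 2 / (cmod a + 1).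
have a1 : 0 < cmod a + 1 by rewrite ltr_wpDl ?cmod_ge0.
have e10 : 0 < e1 by rewrite !divr_gt0.
have e20 : 0 < e / 2 by rewrite divr_gt0.
have [T' VT' bT'] := hT _ e10; have [U' VU' bU'] := hU _ e20.
exists (a *: T' + U')%R; first exact: Vl.
have -> : (a *: T + U - (a *: T' + U'))%R = a *: (T - T') + (U - U').
  by rewrite scalerBr opprD addrACA.
apply: op_bound_le (op_bound_comb a bT' bU').
rewrite [leRHS](splitr e) lerD2r /e1 mulrC mulrAC ler_pdivrMr// ler_pM2l//.
by rewrite lerDl.
Qed.

(** * Creation operators *)

Lemma Lop_lin i : lin (@Lop R d i).
Proof.
move=> a x y; apply: ell2P => -[|j v].
  by rewrite ell2D ell2Z /= mulr0 addr0.
by rewrite ell2D ell2Z /=; case: ifP; rewrite ?mulr0 ?addr0.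
Qed.

Lemma Lop_bd i : op_bound (@Lop R d i) 1.
Proof.
move=> x; rewrite mul1r; apply: hnorm_le_sqsum => [|n]; first exact: hnorm_ge0.
apply: le_trans (sqsum_le _ (leqnSn n)) _; apply: le_trans (sqsum_le_hnorm x n).
rewrite /sqsum big_words_cons /= absq0 add0r (bigD1 i)//= eqxx [X in _ + X <= _]big1 ?addr0// => j.
by move=> /negbTE ji; rewrite big1// => w _; rewrite ji absq0.
Qed.

Lemma Lword_lin w : lin (@Lword R d w).
Proof. by elim: w => [|i w IH]; [exact: lin_id|exact: (lin_comp (Lop_lin i))]. Qed.

Lemma Lword_bd w : op_bound (@Lword R d w) 1.
Proof.
elim: w => [|i w IH] x; rewrite mul1r//=.
by apply: le_trans (Lop_bd i _) _; rewrite mul1r; apply: le_trans (IH x) _; rewrite mul1r.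
Qed.

Lemma Lword_bounded w : bounded_op (@Lword R d w).
Proof. by apply/bounded_opP; split; [exact: Lword_lin|exists 1 => //; exact: Lword_bd]. Qed.

Lemma Lop_bounded i : bounded_op (@Lop R d i).
Proof. exact: (Lword_bounded [:: i]). Qed.

Lemma bounded_sum I (r : seq I) (P : pred I) (F : I -> op) :
  (forall i, P i -> bounded_op (F i)) -> bounded_op (\sum_(i <- r | P i) F i : op).
Proof.
move=> h; elim/big_rec: _ => [|i U Pi bU]; first exact: bounded_0.
by rewrite -[F i]scale1r; apply: bounded_comb => //; exact: h.
Qed.

Lemma Lsym_bounded n : bounded_op (@Lsym R d n).
Proof. by apply: bounded_sum => w _; exact: Lword_bounded. Qed.

Lemma span_Lsym_bounded : @span_Lsym R d `<=` @bounded_op R d.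
Proof.
move=> _ [s ->]; apply: bounded_sum => p _.
rewrite -[_ *: _]addr0; apply: bounded_comb; [exact: Lsym_bounded|exact: bounded_0].
Qed.

Lemma span_Lsym_lin : op_subspace (@span_Lsym R d).
Proof.
move=> a _ _ [s ->] [t ->].
exists ([seq (a * p.1, p.2) | p <- s] ++ t); rewrite big_cat big_map /=.
congr (_ + _)%R; rewrite scaler_sumr; apply: eq_bigr => p _.
by rewrite scalerA.
Qed.

Lemma span_Lsym0 : @span_Lsym R d 0%R.
Proof. by exists [::]; rewrite big_nil. Qed.

Lemma Sspace_lin : op_subspace (@Sspace R d).
Proof. exact: opclosure_lin span_Lsym_bounded span_Lsym_lin. Qed.

Lemma span_Sspace : @span_Lsym R d `<=` @Sspace R d.
Proof. exact: sub_opclosure span_Lsym_bounded. Qed.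

Lemma Sspace_bounded : @Sspace R d `<=` @bounded_op R d.
Proof. exact: opclosure_bounded. Qed.

Lemma Sstar_lin : op_subspace (@Sstar R d).
Proof.
move=> a T U [T' ST' aT] [U' SU' aU]; exists (a^* *: T' + U')%R; first exact: Sspace_lin.
by have := is_adjoint_comb a^* aT aU; rewrite conjCK.
Qed.

Lemma Sspace0 : @Sspace R d 0%R.
Proof. exact/span_Sspace/span_Lsym0. Qed.

Lemma Sstar0 : @Sstar R d 0%R.
Proof. by exists 0%R; [exact: Sspace0|exact: is_adjoint_0]. Qed.

Lemma Sstar_bounded : @Sstar R d `<=` @bounded_op R d.
Proof. by move=> T [U _ []]. Qed.

Lemma SplusSstar_bounded : @SplusSstar R d `<=` @bounded_op R d.
Proof.
move=> _ [A [B [SA SB ->]]]; rewrite -[A]scale1r.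
by apply: bounded_comb; [exact: Sspace_bounded|exact: Sstar_bounded].
Qed.

Lemma SplusSstar_lin : op_subspace (@SplusSstar R d).
Proof.
move=> a _ _ [A [B [SA SB ->]]] [A' [B' [SA' SB' ->]]].
exists (a *: A + A')%R, (a *: B + B')%R; split.
- exact: Sspace_lin.
- exact: Sstar_lin.
- by rewrite scalerDr addrACA.
Qed.

Lemma SplusSstar_adj T U : SplusSstar T -> is_adjoint T U -> SplusSstar U.
Proof.
move=> [A [B [SA [A' SA' aA'] ->]]] aU.
have [B' aB'] := adjoint_exists (Sspace_bounded SA).
exists A', B'; split => //; first by exists A.
have aB := is_adjoint_sym (Sspace_bounded SA') aA'.
have := is_adjoint_comb 1 aB' aB; rewrite conjC1 !scale1r => h.
by rewrite addrC; exact: is_adjoint_unique aU h.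
Qed.

Lemma SSbar_bounded : @SSbar R d `<=` @bounded_op R d.
Proof. exact: opclosure_bounded. Qed.

Lemma SSbar_lin : op_subspace (@SSbar R d).
Proof. exact: opclosure_lin SplusSstar_bounded SplusSstar_lin. Qed.

Lemma Sspace_SSbar : @Sspace R d `<=` @SSbar R d.
Proof.
move=> T ST; apply: sub_opclosure; first exact: SplusSstar_bounded.
by exists T, 0%R; split => //; [exact: Sstar0|rewrite addr0].
Qed.

Lemma Sstar_SSbar : @Sstar R d `<=` @SSbar R d.
Proof.
move=> T ST; apply: sub_opclosure; first exact: SplusSstar_bounded.
by exists 0%R, T; split => //; [exact: Sspace0|rewrite add0r].
Qed.

Lemma SSbar_closed T : bounded_op T ->
  (forall e : R, 0 < e -> exists2 U, SSbar U & op_bound (T - U)%R e) -> SSbar T.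
Proof.
move=> bT h; apply/(opclosureP _ SplusSstar_bounded); split => // e e0.
have e20 : 0 < e / 2 by rewrite divr_gt0.
have [U /(opclosureP _ SplusSstar_bounded)[bU hU] bTU] := h _ e20.
have [W SW bUW] := hU _ e20; exists W => //.
have -> : (T - W)%R = 1 *: (T - U) + (U - W) by rewrite scale1r addrA subrK.
by apply: op_bound_le (op_bound_comb 1 bTU bUW); rewrite cmod1 mul1r -splitr.
Qed.

(** Taking adjoints preserves norm bounds and exchanges the two summands. *)
Lemma SSbar_adj T U : SSbar T -> is_adjoint T U -> SSbar U.
Proof.
move=> /(opclosureP _ SplusSstar_bounded)[bT hT] aU.
apply/(opclosureP _ SplusSstar_bounded); split; first by case: aU.
move=> e e0; have [A SA bA] := hT e e0.
have [A' aA'] := adjoint_exists (SplusSstar_bounded SA).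
exists A'; first exact: SplusSstar_adj SA aA'.
have := is_adjoint_comb (-1) aA' aU; rewrite rmorphN1 -!combE.
by move=> /adjoint_op_bound; apply => //; exact: ltW.
Qed.

(** * Homogeneous sums of words *)

Lemma sum_count_mem (w : word) : (\sum_(i < d) count_mem i w)%N = size w.
Proof.
elim: w => [|j w IH]; first by rewrite big1.
rewrite big_split /= IH (bigD1 j)//= eqxx big1 ?addn0// => i.
by rewrite eq_sym => /negbTE ->.
Qed.

Lemma Lsym_size n k : (\sum_(i < d) n i)%N = k ->
  @Lsym R d n = \sum_(w : k.-tuple 'I_d | [forall i, count_mem i w == n i]) @Lword R d w.
Proof. by move=> <-. Qed.

(** A weight that depends only on the letter counts is constant on the words
    that make up one [L^(n)]; the counts of a word of length [k] are at most
    [k], so the words are grouped over a finite set of count functions. *)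
Lemma span_homogeneous k (c : ('I_d -> nat) -> C) :
  @span_Lsym R d (\sum_(w : k.-tuple 'I_d) c (fun i => count_mem i w) *: @Lword R d w)%R.
Proof.
pose p (w : k.-tuple 'I_d) : {ffun 'I_d -> 'I_k.+1} := [ffun i => inord (count_mem i w)].
have pE w i : p w i = count_mem i w :> nat.
  by rewrite ffunE inordK// ltnS -[leqRHS](size_tuple w) count_size.
pose nn (n : {ffun 'I_d -> 'I_k.+1}) : 'I_d -> nat := fun i => n i.
exists [seq (if (\sum_(i < d) nn n i == k)%N then c (nn n) else 0, nn n) |
  n <- enum {: {ffun 'I_d -> 'I_k.+1}}].
rewrite big_map big_enum /= (partition_big p xpredT)//=.
apply: eq_bigr => n _.
have cE w : (p w == n) -> c (fun i => count_mem i w) = c (nn n).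
  by move=> /eqP <-; congr c; apply/funext => i; rewrite /nn pE.
case: eqP => [e|ne].
  rewrite (Lsym_size e) scaler_sumr; apply: eq_big => [w|w /cE ->//].
  apply/eqP/forallP => [<- i|h]; first by rewrite /nn pE.
  by apply/ffunP => i; apply: val_inj; rewrite /= pE (eqP (h i)).
rewrite scale0r big1// => w /eqP h; case: ne.
rewrite -[RHS](size_tuple w) -sum_count_mem; apply: eq_bigr => i _.
by rewrite /nn -h pE.
Qed.

Lemma SSbar_id : SSbar (id : op).
Proof.
apply/Sspace_SSbar/span_Sspace.
suff -> : (id : op) = \sum_(w : 0.-tuple 'I_d) (1 : C) *: @Lword R d w.
  exact: (span_homogeneous 0 (fun=> 1)).
rewrite (bigD1 [tuple])//= scale1r big1 ?addr0// => w /eqP; case.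
exact: tuple0.
Qed.

(** * States *)

Section States.
Variables (mu : op -> C) (hmu : is_state mu).

Lemma state_lin (a : C) T U : SSbar T -> SSbar U -> mu (a *: T + U)%R = a * mu T + mu U.
Proof. by case: hmu => h _; exact: h. Qed.

Lemma SSbar0 : SSbar (0 : op).
Proof. by apply/Sspace_SSbar/Sspace0. Qed.

Lemma SSbarZ (a : C) T : SSbar T -> SSbar (a *: T : op).
Proof. by move=> hT; have := SSbar_lin a hT SSbar0; rewrite addr0. Qed.

Lemma stateZ (a : C) T : SSbar T -> mu (a *: T)%R = a * mu T.
Proof.
move=> hT; have m0 : mu 0%R = 0.
  by have := state_lin (-1) hT hT; rewrite scaleN1r addNr mulN1r addNr.
by have := state_lin a hT SSbar0; rewrite !addr0 m0 addr0.
Qed.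

(** For a pair [T, U] of adjoint operators of norm at most [M], the operators
    [2 M +- (T + U)] are positive. *)
Lemma state_pair T U M : SSbar T -> is_adjoint T U -> 0 <= M -> op_bound T M ->
  cIm (mu T + mu U) = 0 /\ `|cRe (mu T + mu U)| <= 2 * M * cRe (mu id).
Proof.
move=> hT aU M0 hM; have hU := SSbar_adj hT aU.
have pos (s : R) : s ^+ 2 = 1 ->
    positive_op (mkC (2 * M) 0 *: (id : op) + mkC s 0 *: (1 *: T + U))%R.
  move=> s2 x; rewrite scale1r !(opD, opZ) dotpDl !dotpZl dotpDl dotp_self.
  have -> : dotp (U x) x = (dotp (T x) x)^* by rewrite aU.2 -dotp_sym.
  have h : `|cRe (dotp (T x) x)| <= M * hn x ^+ 2.
    apply: le_trans (cRe_le_cmod _) _; apply: le_trans (dotp_CS _ _) _.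
    by rewrite expr2 mulrA ler_wpM2r ?hnorm_ge0.
  rewrite cleE; apply/andP; split.
    apply/eqP; rewrite !(cReD, cImD, cReM, cImM, cReC, cImC, cRemk, cImmk, cIm0); ring.
  rewrite !(cReD, cImD, cReM, cImM, cReC, cImC, cRemk, cImmk, cRe0).
  move: h; rewrite ler_norml => /andP[h1 h2].
  have : s = 1 \/ s = -1.
    move/eqP: s2; rewrite sqrf_eq1 => /orP[]/eqP; by [left|right].
  by case=> ->; lra.
have hs (s : R) : s ^+ 2 = 1 -> 0 <= mkC (2 * M) 0 * mu id + mkC s 0 * (mu T + mu U).
  move=> /pos/hmu.2; rewrite state_lin; first 1 last.
  - exact: SSbar_id.
  - by apply/SSbarZ/SSbar_lin.
  rewrite stateZ; last exact: SSbar_lin.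
  by rewrite state_lin// mul1r; apply; apply: SSbar_lin;
    [exact: SSbar_id|apply/SSbarZ/SSbar_lin].
have h0 : 0 <= mu id.
  by apply: hmu.2 SSbar_id _ => x; rewrite dotp_self cleE eqxx sqr_ge0.
have := hs 1 (expr1n _ _); have := hs (-1) (_ : _ = 1); rewrite sqrrN expr1n => /(_ erefl).
move: h0; move: (mu id) (mu T + mu U) => p q.
rewrite !cleE !(cReD, cImD, cReM, cImM, cRemk, cImmk, cRe0, cIm0).
move=> /andP[/eqP e1 _] /andP[/eqP e2 i2] /andP[/eqP e3 i3].
split; first by rewrite e1 in e3; lra.
by rewrite ler_norml; apply/andP; split; rewrite ?e1 in i2 i3 *; lra.
Qed.

(** The pair inequality for [T] makes [mu T + mu U] real, and for [i T] it makes
    [i (mu T - mu U)] real. *)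
Lemma state_adjoint T U : SSbar T -> is_adjoint T U -> mu U = (mu T)^*.
Proof.
move=> hT aU; have hU := SSbar_adj hT aU.
have /bounded_opP[_ [M M0 hM]] := SSbar_bounded hT.
have [h _] := state_pair hT aU M0 hM.
have aiU : is_adjoint (mkC 0 1 *: T : op)%R ((mkC 0 1)^* *: U : op)%R.
  have := is_adjoint_comb (mkC 0 1) aU (is_adjoint_0 R d).
  by rewrite !addr0.
have hiT : op_bound (mkC 0 1 *: T)%R M.
  move=> x; rewrite opZ hnorm_scale; apply: le_trans (_ : 1 * hn (T x) <= _).
    by rewrite /cmod /absq cRemk cImmk expr1n expr0n /= add0r sqrtr1.
  by rewrite mul1r.
have [h' _] := state_pair (SSbarZ (mkC 0 1) hT) aiU M0 hiT.
move: h h'; rewrite !stateZ// !(cReD, cImD, cReM, cImM, cReC, cImC, cRemk, cImmk).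
by move=> h h'; apply: cplx_eq; rewrite ?cReC ?cImC; lra.
Qed.

(** Real and imaginary parts are bounded separately, whence the factor [2]. *)
Lemma state_bound T M : SSbar T -> 0 <= M -> op_bound T M ->
  cmod (mu T) <= 2 * M * cRe (mu id).
Proof.
have re (V : op) N : SSbar V -> 0 <= N -> op_bound V N -> `|cRe (mu V)| <= N * cRe (mu id).
  move=> hV N0 hN; have [U aU] := adjoint_exists (SSbar_bounded hV).
  have [_] := state_pair hV aU N0 hN; rewrite (state_adjoint hV aU) cReD cReC.
  by rewrite (_ : _ + _ = 2 * cRe (mu V)); [rewrite normrM ger0_norm// -mulrA ler_pM2l|ring].
move=> hT M0 hM; apply: le_trans (cmod_le _) _.
have hiT : op_bound (mkC 0 1 *: T)%R M.
  move=> x; rewrite opZ hnorm_scale; apply: le_trans (_ : 1 * hn (T x) <= _).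
    by rewrite /cmod /absq cRemk cImmk expr1n expr0n /= add0r sqrtr1.
  by rewrite mul1r.
have h1 := re _ _ hT M0 hM; have := re _ _ (SSbarZ (mkC 0 1) hT) M0 hiT.
rewrite stateZ// cReM cRemk cImmk mul0r mul1r sub0r normrN => h2.
by rewrite -mulrA mulr_natl mulr2n lerD.
Qed.

End States.
End OperatorSystem.

(** * Powers of an operator and the Neumann series *)

Section Neumann.
Variables (R : realType) (d : nat).
Local Notation C := (Cplx R).
Local Notation word := (word d).
Local Notation ell2 := (ell2 R d).
Local Notation op := (op R d).
Local Notation hn := (hnorm (@dotp R d)).
Implicit Types (T U A B : op) (W : set op).

Lemma lin_iter A n : lin A -> lin (iter n A).
Proof. by move=> hA; elim: n => [|n IH] a x y //=; rewrite IH hA. Qed.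

Lemma op_bound_iter A r n : 0 <= r -> op_bound A r -> op_bound (iter n A) (r ^+ n).
Proof.
move=> r0 hA; elim: n => [|n IH] x /=; first by rewrite expr0 mul1r.
by apply: le_trans (hA _) _; rewrite exprS -mulrA ler_wpM2l.
Qed.

Lemma bounded_iter A n : bounded_op A -> bounded_op (iter n A : op).
Proof.
move=> /bounded_opP[hA [M M0 hM]]; apply/bounded_opP; split; first exact: lin_iter.
by exists (M ^+ n); [exact: exprn_ge0|exact: op_bound_iter].
Qed.

Lemma is_adjoint_iter T U n : is_adjoint T U -> is_adjoint (iter n T : op) (iter n U : op).
Proof.
move=> aT; elim: n => [|n IH]; first exact: is_adjoint_id.
have -> : (iter n.+1 U : op) = iter n U \o U by apply/funext => x; rewrite iterSr.
exact: is_adjoint_comp aT IH.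
Qed.

Lemma iterZ (a : C) A n : lin A -> (iter n (a *: A) : op) = (a ^+ n *: iter n A : op)%R.
Proof.
move=> hA; apply/funext => x; rewrite opZ.
elim: n => [|n IH]; first by rewrite expr0 scale1r.
by rewrite iterS IH opZ linZ// scalerA -exprS.
Qed.

Variables (A : op) (r : R).
Hypotheses (hA : lin A) (r0 : 0 <= r) (r12 : r <= 2^-1) (bA : op_bound A r).

Let S n : op := \sum_(k < n) iter k A.

Let S0 x : S 0 x = 0.
Proof. by rewrite /S big_ord0. Qed.

Let SS n x : S n.+1 x = x + A (S n x).
Proof.
rewrite /S !op_sum big_ord_recl /=. by rewrite (lin_sum _ _ _ hA).
Qed.

Let Sbd n x : hn (S n x) <= 2 * hn x.
Proof.
elim: n => [|n IH]; first by rewrite S0 hnorm_zero mulr_ge0 ?hnorm_ge0.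
rewrite SS; apply: le_trans (hnorm_add _ _) _.
have h1 := bA (S n x); have h2 := hnorm_ge0 (@dotp R d) (S n x).
have h3 : r * hn (S n x) <= 2^-1 * hn (S n x) by rewrite ler_wpM2r.
lra.
Qed.

Let Sadd m p x : S (m + p) x = S m x + iter m A (S p x).
Proof.
elim: m => [|m IH]; first by rewrite S0 add0r.
by rewrite addSn !SS IH linD// addrA.
Qed.

Let Scauchy x m n : (m <= n)%N -> hn (S n x - S m x) <= 2 * r ^+ m * hn x.
Proof.
move=> mn; rewrite -(subnKC mn) Sadd addrC addKr.
apply: le_trans (op_bound_iter m r0 bA _) _.
by rewrite -mulrA mulrCA ler_wpM2l ?exprn_ge0// Sbd.
Qed.

Let rn_cvg (a b : R) : (fun n => a * r ^+ n * b) @ \oo --> (0 : R).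
Proof.
have h : (fun n => a * r ^+ n * b) @ \oo --> a * 0 * b.
  apply: cvgMr_tmp; apply: cvgMl_tmp; apply: cvg_expr.
  by rewrite ger0_norm//; apply: le_lt_trans r12 _; rewrite invf_lt1// ltr1n.
by rewrite mulr0 mul0r in h.
Qed.

Let small_eq (x y : ell2) (a b : R) :
  (forall n, hn (x - y) <= a * r ^+ n * b) -> x = y.
Proof.
move=> h; apply/subr0_eq/hnorm_eq0/eqP; rewrite eq_le hnorm_ge0 andbT.
by apply: (cvgr_to_ge (rn_cvg a b)); apply: nearW => n; exact: h.
Qed.

(** The partial sums [S n] satisfy [S (m + p) = S m + A^m S p] with
    [|S p| <= 2], which is where [r <= 1/2] enters: they are Cauchy with rate
    [2 r^n], and the same rate is the error in the last clause. *)
Lemma neumann : exists U : op, [/\ bounded_op U,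
  forall x, U x - A (U x) = x, forall x, U (x - A x) = x &
  forall N, op_bound (U - \sum_(k < N) iter k A)%R (2 * r ^+ N)].
Proof.
have ex x : exists y, forall n, hn (y - S n x) <= 2 * r ^+ n * hn x.
  by apply: ell2_complete (rn_cvg _ _) _ => m n; exact: Scauchy.
have [U hU] := choice ex.
have Slin n : lin (S n).
  elim: n => [|n IH] a x y; first by rewrite !S0 scaler0 addr0.
  by rewrite !SS IH hA scalerDr addrACA.
have Ulin : lin U.
  move=> a x y.
  apply: (@small_eq _ _ 2 (hn (a *: x + y) + (cmod a * hn x + hn y))) => n.
  rewrite mulrDr.
  have -> : U (a *: x + y) - (a *: U x + U y) =
    (U (a *: x + y) - S n (a *: x + y)) - (a *: (U x - S n x) + (U y - S n y)).
    rewrite (_ : a *: (U x - S n x) + _ = a *: U x + U y - S n (a *: x + y)).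
      by rewrite opprB addrA subrK.
    by rewrite Slin scalerBr opprD addrACA.
  apply: le_trans (hnorm_add _ _) _; rewrite hnorm_opp lerD//.
  apply: le_trans (hnorm_add _ _) _; rewrite hnorm_scale mulrDr lerD//.
  by rewrite mulrCA ler_wpM2l ?cmod_ge0.
exists U; split.
- apply/bounded_opP; split => //; exists 2 => // x.
  by have := hU x 0%N; rewrite S0 subr0 expr0 mulr1.
- move=> x; apply: (@small_eq _ _ (2 * r + 2) (hn x)) => n.
  have -> : U x - A (U x) - x = (U x - S n.+1 x) - A (U x - S n x).
    by rewrite SS linB// opprB opprD !addrA subrK addrAC.
  apply: le_trans (hnorm_add _ _) _; rewrite hnorm_opp.
  have h1 := hU x n.+1; have h2 := bA (U x - S n x).
  have h3 : r * hn (U x - S n x) <= r * (2 * r ^+ n * hn x) by rewrite ler_wpM2l.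
  have r1 : r <= 1 by apply: le_trans r12 _; rewrite invf_le1// ler1n.
  have h4 : 0 <= r ^+ n * hn x by rewrite mulr_ge0 ?hnorm_ge0 ?exprn_ge0.
  have h5 : r * (r ^+ n * hn x) <= r ^+ n * hn x by rewrite ler_piMl.
  apply: le_trans (lerD h1 (le_trans h2 h3)) _; rewrite exprS.
  move: h4 h5; set w := r ^+ n; set v := hn x => h4 h5.
  have -> : 2 * (r * w) * v + r * (2 * w * v) = 2 * (r * (w * v)) + 2 * (r * (w * v)) by ring.
  have -> : (2 * r + 2) * w * v = 2 * (r * (w * v)) + 2 * (w * v) by ring.
  by rewrite lerD2l ler_pM2l.
- move=> x; apply: (@small_eq _ _ 1 (2 * hn (x - A x) + hn x)) => n.
  have e : S n (x - A x) = x - iter n A x.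
    elim: n => [|n IH]; first by rewrite S0 subrr.
    by rewrite SS IH linB// iterS addrA subrK.
  have -> : U (x - A x) - x = (U (x - A x) - S n (x - A x)) - iter n A x.
    by rewrite e opprB addrA addrAC addrK.
  apply: le_trans (hnorm_add _ _) _; rewrite hnorm_opp.
  have h1 := hU (x - A x) n; have h2 := op_bound_iter n r0 bA x.
  by rewrite mul1r mulrDr; apply: lerD => //; rewrite mulrA (mulrC _ 2).
- by move=> N x; exact: hU.
Qed.

End Neumann.

(** * Herglotz operators span a dense subspace *)

Section Density.
Variables (R : realType) (d : nat).
Local Notation C := (Cplx R).
Local Notation word := (word d).
Local Notation ell2 := (ell2 R d).
Local Notation op := (op R d).
Local Notation hn := (hnorm (@dotp R d)).
Implicit Types (T U A B : op) (W : set op).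

Lemma adj_Lop i : is_adjoint (@Lop R d i) (adj (@Lop R d i)).
Proof. by have [U aU] := adjoint_exists (Lop_bounded R i); rewrite (adj_eq aU). Qed.

Lemma is_adjoint_sum I (r : seq I) (P : pred I) (c : I -> C) (F G : I -> op) :
  (forall i, is_adjoint (F i) (G i)) ->
  is_adjoint (\sum_(i <- r | P i) c i *: F i : op) (\sum_(i <- r | P i) (c i)^* *: G i : op).
Proof.
move=> h; elim/big_rec2: _ => [|i A B _ aAB]; first exact: is_adjoint_0.
exact: is_adjoint_comb.
Qed.

(** The adjoint of [zLstar] up to conjugating the coefficients. *)
Definition creation (c : 'I_d -> C) : op := \sum_(j < d) c j *: @Lop R d j.

Lemma creation_adj (z : 'rV[C]_d) : is_adjoint (creation (fun j => (z 0 j)^*)) (zLstar z).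
Proof.
have := is_adjoint_sum (index_enum 'I_d) xpredT (fun j => (z 0 j)^*) adj_Lop.
by under [X in is_adjoint _ X -> _]eq_bigr do rewrite conjCK.
Qed.

Lemma zLstar_bounded z : bounded_op (@zLstar R d z).
Proof. by case: (creation_adj z). Qed.

Lemma creation_bounded c : bounded_op (creation c).
Proof.
apply: bounded_sum => j _; rewrite -[c j *: _]addr0.
by apply: bounded_comb; [exact: Lop_bounded|exact: bounded_0].
Qed.

Lemma zLstar_bd z : op_bound (@zLstar R d z) (\sum_(j < d) cmod (z 0 j)).
Proof.
rewrite /zLstar; elim/big_rec2: _ => [|j M A _ h] x.
  by rewrite hnorm_zero mul0r.
rewrite opD opZ; apply: le_trans (hnorm_add _ _) _; rewrite hnorm_scale mulrDl lerD//.
rewrite ler_wpM2l ?cmod_ge0//.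
have := adjoint_op_bound ler01 (adj_Lop j) (@Lop_bd R d j) x.
by rewrite mul1r.
Qed.

Lemma zLstarZ (a : C) z : zLstar (a *: z) = (a *: @zLstar R d z)%R.
Proof.
by rewrite /zLstar scaler_sumr; apply: eq_bigr => j _; rewrite mxE scalerA.
Qed.

Lemma zLstar_vacuum z : @zLstar R d z (xi R [::]) = 0.
Proof.
rewrite /zLstar op_sum big1// => j _; rewrite opZ.
rewrite (_ : adj _ _ = 0) ?scaler0//; apply: ell2P => w.
by rewrite -dotp_xi dotp_sym -(adj_Lop j).2 Lop_xi dotp_xi /= /dirac_fun /= conjC0.
Qed.

(** * The Herglotz operators *)

Lemma opinv_eq T U : bounded_op U -> T \o U = id -> U \o T = id -> opinv T = U.
Proof.
move=> bU h1 h2; rewrite /opinv; case: xgetP => [V _ /= [_ [_ k2]]|/(_ U)]; last first.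
  by move=> /= n; case: n.
apply/funext => x; have := congr1 (fun f => V (f x)) h1.
by have := congr1 (fun f => f (U x)) k2 => /= -> ->.
Qed.

(** From [(1 - A) U = 1] comes [A U = U - 1], so [(1 + A) U = 2 U - 1]. The
    series fixes the vacuum vector since [A] kills it. *)
Lemma herglotzE (z : 'rV[C]_d) : \sum_(j < d) cmod (z 0 j) <= 2^-1 ->
  exists U : op, [/\ bounded_op U, herglotz_op z = (2 *: U - id)%R,
    U (xi R [::]) = xi R [::] &
    forall N, op_bound (U - \sum_(k < N) iter k (zLstar z))%R
      (2 * (\sum_(j < d) cmod (z 0 j)) ^+ N)].
Proof.
move=> hz; have r0 : 0 <= \sum_(j < d) cmod (z 0 j).
  by apply: sumr_ge0 => j _; exact: cmod_ge0.
have [U [bU h1 h2 h3]] := neumann (bounded_lin (zLstar_bounded z)) r0 hz (zLstar_bd z).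
exists U; split => //; last first.
  by rewrite -[RHS](h2 (xi R [::])) zLstar_vacuum subr0.
rewrite /herglotz_op (_ : opinv _ = U).
  apply/funext => x; rewrite opB opZ.
  have e : zLstar z (U x) = U x - x by rewrite -[X in _ - X](h1 x) opprB addrC subrK.
  by rewrite -[LHS]/(U x + zLstar z (U x)) e addrA scaler_nat mulr2n.
by apply: opinv_eq => //; apply/funext => x /=; rewrite ?opB ?h1 ?h2.
Qed.

Lemma herglotz0 : herglotz_op 0 = (id : op).
Proof.
have z0 : @zLstar R d 0 = 0%R.
  by rewrite /zLstar big1// => j _; rewrite mxE scale0r.
rewrite /herglotz_op z0 subr0 addr0 (@opinv_eq id id)//.
exact: bounded_id.
Qed.

(** * Extracting coefficients *)

(** An asymptotic expansion with values in [W] at every order has its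
    coefficients in [W]: once the first [k] coefficients are known, divide the
    remainder of order [k] by [t^k] and let [t] tend to [0]. *)
Lemma extract_coefficients W (F : R -> op) (A : nat -> op) :
  op_subspace W ->
  (forall T, bounded_op T ->
    (forall e : R, 0 < e -> exists2 U, W U & op_bound (T - U)%R e) -> W T) ->
  (forall t, 0 < t -> t <= 1 -> W (F t)) ->
  (forall k, bounded_op (A k)) ->
  (forall N, exists2 K, 0 <= K & forall t, 0 < t -> t <= 1 ->
     op_bound (F t - \sum_(k < N) mkC (t ^+ k) 0 *: A k)%R (K * t ^+ N)) ->
  forall k, W (A k).
Proof.
move=> Wl Wc WF bA hF k; elim/ltn_ind: k => k IH.
have W0 : W 0%R.
  have := Wl (-1) _ _ (WF 1 ltr01 (lexx _)) (WF 1 ltr01 (lexx _)).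
  by rewrite scaleN1r addNr.
apply: Wc => // e e0; have [K K0 hK] := hF k.+1.
(* The remainder divided by [t ^ k] has size [K t], which this [t] brings below
   [e]. *)
pose t := Num.min 1 (e / (K + 1)).
have K1 : 0 < K + 1 by rewrite ltr_wpDl.
have t0 : 0 < t by rewrite lt_min ltr01 divr_gt0.
have t1 : t <= 1 by rewrite ge_min lexx.
have te : K * t <= e.
  apply: le_trans (_ : (K + 1) * t <= e); first by rewrite ler_wpM2r ?lerDl// ltW.
  by rewrite mulrC -ler_pdivlMr// ge_min lexx orbT.
pose P := \sum_(j < k) mkC (t ^+ j) 0 *: A j.
have WP : W P.
  rewrite /P; elim/big_ind: _ => [//|T U hT hU|j _].
    by rewrite -[T]scale1r; exact: Wl.
  by rewrite -[_ *: A j]addr0; apply: Wl => //; exact: IH.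
have tk0 : (mkC (t ^+ k) 0 : C) != 0.
  apply/negP => /eqP/(congr1 (@cRe R)) /eqP; rewrite cRemk cRe0.
  by rewrite expf_eq0 (gt_eqF t0) andbF.
exists ((mkC (t ^+ k) 0)^-1 *: ((-1) *: P + F t) + 0)%R.
  by apply: (Wl) => //; apply: Wl => //; exact: WF.
have -> : (A k - ((mkC (t ^+ k) 0)^-1 *: ((-1) *: P + F t) + 0))%R =
   (- (mkC (t ^+ k) 0)^-1) *: (F t - \sum_(j < k.+1) mkC (t ^+ j) 0 *: A j) + 0.
  rewrite !addr0 big_ord_recr /= -/P scaleN1r scaleNr opprD addrA.
  by rewrite [in RHS]scalerBr scalerA mulVf// scale1r opprB [- P + _]addrC.
move=> x; rewrite addr0 opZ hnorm_scale cmodN.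
have cE : cmod ((mkC (t ^+ k) 0)^-1) = (t ^+ k)^-1.
  have tp : 0 < t ^+ k by exact: exprn_gt0.
  apply: (mulfI (lt0r_neq0 tp)).
  rewrite divff ?lt0r_neq0// -[X in X * _](ger0_norm (ltW tp)) -cmod_real -cmodM.
  by rewrite divff// cmod1.
rewrite cE mulrC ler_pdivrMr ?exprn_gt0//.
apply: le_trans (hK t t0 t1 x) _.
rewrite exprSr (_ : K * _ * _ = K * t * (hn x * t ^+ k)); last by ring.
by rewrite -[leRHS]mulrA ler_wpM2r// mulr_ge0 ?hnorm_ge0 ?exprn_ge0 ?ltW.
Qed.

(** The first digit is the remainder modulo [K]; divide and recurse. *)
Lemma sum_base_inj K n (f g : 'I_n -> nat) :
  (forall i, f i < K)%N -> (forall i, g i < K)%N ->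
  (\sum_(i < n) f i * K ^ i)%N = (\sum_(i < n) g i * K ^ i)%N -> forall i, f i = g i.
Proof.
elim: n f g => [|n IH] f g hf hg; first by move=> _ [].
have shift (h : 'I_n.+1 -> nat) : (\sum_(i < n.+1) h i * K ^ i)%N =
    (h ord0 + (\sum_(i < n) h (lift ord0 i) * K ^ i) * K)%N.
  rewrite big_ord_recl expn0 muln1 big_distrl /=; congr (_ + _)%N.
  by apply: eq_bigr => i _; rewrite /bump /= add1n expnSr mulnA.
rewrite !shift => e.
have K0 : (0 < K)%N by apply: leq_ltn_trans (hf ord0).
have e0 : f ord0 = g ord0.
  have := congr1 (modn^~ K) e.
  by rewrite ![(_ + _ * K)%N]addnC !modnMDl !modn_small.
move/eqP: e; rewrite e0 eqn_add2l eqn_pmul2r// => /eqP/IH e1 i.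
by case: (unliftP ord0 i) => [j ->|->//]; apply: e1.
Qed.

Lemma big_words_size (V : nmodType) n (F : word -> V) :
  \sum_(w <- words d n.+1) (if size w == n then F w else 0) = \sum_(w : n.-tuple 'I_d) F w.
Proof.
rewrite big_words big_ord_recr /= big1 ?add0r => [|i _].
  by apply: eq_bigr => w _; rewrite size_tuple eqxx.
by rewrite big1// => w _; rewrite size_tuple (ltn_eqF (ltn_ord i)).
Qed.

Lemma big_tuple_cons (V : nmodType) n (F : word -> V) :
  \sum_(w : n.+1.-tuple 'I_d) F w = \sum_(j < d) \sum_(w : n.-tuple 'I_d) F (j :: w).
Proof.
rewrite -big_words_size big_words_cons add0r; apply: eq_bigr => j _.
by rewrite -(big_words_size n (fun w => F (j :: w))).
Qed.

Lemma prod_count_mem (c : 'I_d -> C) (j : 'I_d) (w : word) :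
  \prod_(i < d) c i ^+ count_mem i (j :: w) = c j * \prod_(i < d) c i ^+ count_mem i w.
Proof.
rewrite (eq_bigr (fun i => c i ^+ (j == i) * c i ^+ count_mem i w)) => [|i _].
  rewrite big_split /=; congr (_ * _); rewrite (bigD1 j)//= eqxx expr1 big1 ?mulr1//.
  by move=> i; rewrite eq_sym => /negbTE ->.
by rewrite -exprD.
Qed.

Lemma creation_iter k c : (iter k (creation c) : op) =
  \sum_(w : k.-tuple 'I_d) (\prod_(i < d) c i ^+ count_mem i w) *: @Lword R d w.
Proof.
elim: k => [|k IH].
  rewrite (bigD1 [tuple])//= big1 ?scale1r ?big1 ?addr0// => w /eqP; case.
  exact: tuple0.
have -> : (iter k.+1 (creation c) : op) = creation c \o iter k (creation c) by [].
rewrite IH (big_tuple_cons k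
  (fun w => (\prod_(i < d) c i ^+ count_mem i w) *: @Lword R d w : op)); apply/funext => x /=.
rewrite /creation [LHS]op_sum [RHS]op_sum; apply: eq_bigr => j _.
rewrite opZ !op_sum (lin_sum _ _ _ (@Lop_lin R d j)) scaler_sumr.
apply: eq_bigr => w _.
by rewrite prod_count_mem !opZ (linZ _ _ (@Lop_lin R d j)) scalerA.
Qed.

Lemma creation_iter_span k c : @span_Lsym R d (iter k (creation c)).
Proof. by rewrite creation_iter; exact: (span_homogeneous k (fun n => \prod_(i < d) c i ^+ n i)). Qed.

Lemma zLstar_iter_SSbar k z : SSbar (iter k (@zLstar R d z) : op).
Proof.
apply/Sstar_SSbar; exists (iter k (creation (fun j => (z 0 j)^*))).
  exact/span_Sspace/creation_iter_span.
exact/is_adjoint_iter/creation_adj.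
Qed.

Lemma SSbar_sum I (r : seq I) (P : pred I) (F : I -> op) :
  (forall i, P i -> SSbar (F i)) -> SSbar (\sum_(i <- r | P i) F i : op).
Proof.
move=> h; elim/big_ind: _ => [|T U hT hU|//]; first exact: SSbar0.
by rewrite -[T]scale1r; exact: SSbar_lin.
Qed.

Lemma herglotz_SSbar (z : 'rV[C]_d) : \sum_(j < d) cmod (z 0 j) <= 2^-1 ->
  SSbar (herglotz_op z).
Proof.
move=> hz; have [U [bU -> _ h]] := herglotzE hz.
suff hU : SSbar U by rewrite combE; apply: SSbar_lin; [exact: SSbar_id|exact: SSbarZ].
apply: SSbar_closed => // e e0.
set r := \sum_(j < d) _ in hz h.
have r0 : 0 <= r by apply: sumr_ge0 => j _; exact: cmod_ge0.
have hc : (fun n => 2 * r ^+ n) @ \oo --> (2 * 0 : R).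
  apply: cvgMl_tmp; apply: cvg_expr; rewrite ger0_norm//.
  by apply: le_lt_trans hz _; rewrite invf_lt1// ltr1n.
rewrite mulr0 in hc; move/cvgrPdist_lt/(_ e e0): hc => [N _ /(_ N (leqnn N))].
rewrite /= sub0r normrN => /(le_lt_trans (ler_norm _))/ltW hN.
exists (\sum_(k < N) iter k (zLstar z))%R; last exact: op_bound_le hN (h N).
by apply: SSbar_sum => k _; exact: zLstar_iter_SSbar.
Qed.

(** The powers of [z L^*] are extracted first for small [z], then for all [z]
    by homogeneity; passing to adjoints replaces them by powers of creation
    operators, from which the [L^(n)] are extracted. *)
Lemma SSbar_dense W :
  op_subspace W ->
  (forall T U, W T -> is_adjoint T U -> W U) ->
  (forall T, bounded_op T ->
    (forall e : R, 0 < e -> exists2 U, W U & op_bound (T - U)%R e) -> W T) ->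
  (forall z : 'rV[C]_d, \sum_(j < d) cmod (z 0 j) <= 2^-1 -> W (herglotz_op z)) ->
  @SSbar R d `<=` W.
Proof.
move=> Wl Wa Wc WH.
have Wid : W id.
  rewrite -herglotz0; apply: WH.
  by rewrite big1 ?invr_ge0// => j _; rewrite mxE cmod0.
have W0 : W 0%R by have := Wl (-1) _ _ Wid Wid; rewrite scaleN1r addNr.
have WZ (a : C) T : W T -> W (a *: T)%R.
  by move=> hT; have := Wl a _ _ hT W0; rewrite addr0.
have WD T U : W T -> W U -> W (T + U)%R.
  by move=> hT hU; rewrite -[T]scale1r; exact: Wl.
(* Expand the inverse at [t z] in powers of [t]. *)
have Wpow_small (z : 'rV[C]_d) k : \sum_(j < d) cmod (z 0 j) <= 2^-1 ->
    W (iter k (zLstar z)).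
  move=> hz; move: k.
  have cm (t : R) : 0 < t -> \sum_(j < d) cmod ((mkC t 0 *: z) 0 j) =
      t * \sum_(j < d) cmod (z 0 j).
    move=> t0; rewrite mulr_sumr; apply: eq_bigr => j _.
    by rewrite mxE cmodM cmod_real gtr0_norm.
  have r0 : 0 <= \sum_(j < d) cmod (z 0 j).
    by apply: sumr_ge0 => j _; exact: cmod_ge0.
  have small t : 0 < t -> t <= 1 -> \sum_(j < d) cmod ((mkC t 0 *: z) 0 j) <= 2^-1.
    by move=> t0 t1; rewrite cm//; apply: le_trans hz; rewrite ler_piMl.
  apply: (@extract_coefficients W
    (fun t => (2^-1 : C) *: (herglotz_op (mkC t 0 *: z) + id))%R) => //.
  - by move=> t t0 t1; apply: WZ; apply: WD => //; apply/WH/small.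
  - by move=> k; exact/bounded_iter/zLstar_bounded.
  - move=> N; exists 2 => // t t0 t1.
    have [U [bU -> _ /(_ N) h]] := herglotzE (small t t0 t1).
    rewrite subrK scalerA mulVf ?pnatr_eq0// scale1r.
    have e : (\sum_(k < N) iter k (zLstar (mkC t 0 *: z)) : op) =
        \sum_(k < N) mkC (t ^+ k) 0 *: (iter k (zLstar z) : op).
      apply: eq_bigr => k _; rewrite zLstarZ iterZ; last exact/bounded_lin/zLstar_bounded.
      by rewrite mkCX.
    rewrite e cm// in h; apply: op_bound_le h; rewrite exprMn ler_pM2l// ler_piMr//; first by rewrite exprn_ge0// ltW.
    by rewrite exprn_ile1//; apply: le_trans hz _; rewrite invf_le1// ler1n.
(* A multiple of [z] is small, and the powers are homogeneous. *)
have Wpow (z : 'rV[C]_d) k : W (iter k (zLstar z)).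
  pose s : R := \sum_(j < d) cmod (z 0 j).
  have s0 : 0 <= s by apply: sumr_ge0 => j _; exact: cmod_ge0.
  pose a : R := (2 * (s + 1))^-1.
  have a0 : 0 < a by rewrite invr_gt0 mulr_gt0// ltr_wpDl.
  have ca : (mkC a 0 : C) != 0.
    by apply/negP => /eqP/(congr1 (@cRe R)) /eqP; rewrite cRemk cRe0 gt_eqF.
  have -> : z = (mkC a 0)^-1 *: (mkC a 0 *: z) by rewrite scalerA mulVf// scale1r.
  rewrite zLstarZ iterZ; last exact/bounded_lin/zLstar_bounded.
  apply/WZ/Wpow_small.
  rewrite (eq_bigr (fun j => a * cmod (z 0 j))) => [|j _]; last first.
    by rewrite mxE cmodM cmod_real gtr0_norm.
  rewrite -mulr_sumr -/s /a invfM -mulrA ler_piMr ?invr_ge0//.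
  by rewrite mulrC ler_pdivrMr ?mul1r ?lerDl// ltr_wpDl.
have Wcre (c : 'I_d -> C) k : W (iter k (creation c)).
  pose z : 'rV[C]_d := \row_j (c j)^*.
  have -> : creation c = creation (fun j => (z 0 j)^*).
    by apply: eq_bigr => j _; rewrite mxE conjCK.
  apply: Wa (Wpow z k) _; apply: is_adjoint_iter.
  by apply: is_adjoint_sym; [exact: creation_bounded|exact: creation_adj].
(* Words with counts [n] carry the weight [t ^ e], where [e] has the counts as
   its digits in base [k + 1]; the digits are at most [k]. *)
have Wsym n : W (@Lsym R d n).
  pose k := (\sum_(i < d) n i)%N.
  pose e (w : k.-tuple 'I_d) := (\sum_(i < d) count_mem i w * k.+1 ^ i)%N.
  have -> : @Lsym R d n =
      \sum_(w : k.-tuple 'I_d | e w == (\sum_(i < d) n i * k.+1 ^ i)%N) @Lword R d w.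
    apply: eq_bigl => w; apply/forallP/eqP => [h|h i].
      by apply: eq_bigr => i _; rewrite (eqP (h i)).
    apply/eqP; move: i; apply: (sum_base_inj _ _ h) => i.
      by rewrite ltnS -[leqRHS](size_tuple w) count_size.
    by rewrite ltnS /k (bigD1 i)//= leq_addr.
  apply: (@extract_coefficients W
    (fun t => iter k (creation (fun i => mkC (t ^+ (k.+1 ^ i)) 0)))
    (fun m => \sum_(w : k.-tuple 'I_d | e w == m) @Lword R d w)%R) => //.
    by move=> j; apply: bounded_sum => w _; exact: Lword_bounded.
  (* At most all words of length [k] remain, each of weight at most [t ^ N]. *)
  move=> N; exists #|{: k.-tuple 'I_d}|%:R => // t t0 t1.
  have cE (w : k.-tuple 'I_d) :
      \prod_(i < d) (mkC (t ^+ (k.+1 ^ i)) 0 : C) ^+ count_mem i w = mkC (t ^+ e w) 0.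
    rewrite mkCX /e expr_sum; apply: eq_bigr => i _.
    by rewrite mkCX -exprM mulnC.
  pose D (w : k.-tuple 'I_d) : op := mkC (t ^+ e w) 0 *: @Lword R d w.
  have -> : (iter k (creation (fun i => mkC (t ^+ (k.+1 ^ i)) 0)) : op) = \sum_w D w.
    by rewrite creation_iter; apply: eq_bigr => w _; rewrite cE.
  have -> : \sum_(j < N) (mkC (t ^+ j) 0 : C) *:
        (\sum_(w : k.-tuple 'I_d | e w == j) @Lword R d w : op) =
      \sum_w (if (e w < N)%N then D w else 0).
    rewrite (eq_bigr (fun j : 'I_N => \sum_(w | e w == j) D w)) => [|j _]; last first.
      by rewrite scaler_sumr; apply: eq_bigr => w /eqP <-.
    rewrite (exchange_big_dep xpredT)//=; apply: eq_bigr => w _; case: ltnP => h.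
      by rewrite (big_pred1 (Ordinal h))// => j; rewrite -val_eqE /= eq_sym.
    by rewrite big1// => j /eqP ej; move: (ltn_ord j); rewrite ltnNge -ej h.
  rewrite -sumrB => x; rewrite op_sum; apply: le_trans (hnorm_sum _ _ _) _.
  apply: (@le_trans _ _ (\sum_(w : k.-tuple 'I_d) t ^+ N * hn x)); last first.
    by rewrite sumr_const -[leLHS]mulr_natl mulrA.
  apply: ler_sum => w _; case: ltnP => h.
    by rewrite subrr hnorm_zero mulr_ge0 ?exprn_ge0 ?hnorm_ge0// ltW.
  rewrite subr0 /D opZ hnorm_scale cmod_real ger0_norm; last by rewrite exprn_ge0// ltW.
  apply: ler_pM; [by rewrite exprn_ge0// ltW|exact: hnorm_ge0| |].
    by rewrite ler_wiXn2l// ltW.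
  by have := @Lword_bd R d w x; rewrite mul1r.
have Wspan : @span_Lsym R d `<=` W.
  move=> _ [s ->]; elim/big_ind: _ => [//|T U|p _]; first exact: WD.
  exact/WZ/Wsym.
have WS : @Sspace R d `<=` W.
  move=> T /(opclosureP _ (@span_Lsym_bounded R d))[bT h]; apply: Wc => // e e0.
  by have [U /Wspan WU hU] := h e e0; exists U.
move=> T /(opclosureP _ (@SplusSstar_bounded R d))[bT h]; apply: Wc => // e e0.
have [_ [A [B [/WS WA [B' /WS WB' aB] ->]]] hU] := h e e0.
by exists (A + B)%R => //; apply: WD => //; exact: Wa WB' aB.
Qed.

End Density.

(** * Means over the circle *)

Section CircleMean.
Variable R : realType.
Local Notation C := (Cplx R).

Definition mean_int (f : R -> R) : R :=
  (2 * pi)^-1 * \int[lebesgue_measure]_(t in `[0, 2 * pi]) f t.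

Lemma twopi_gt0 : 0 < 2 * pi :> R.
Proof. by rewrite mulr_gt0// pi_gt0. Qed.

Lemma cont_integrable (f : R -> R) : continuous f ->
  lebesgue_measure.-integrable `[0, 2 * pi : R] (EFin \o f).
Proof.
move=> cf; apply: continuous_compact_integrable; first exact: segment_compact.
exact: continuous_subspaceT.
Qed.

Lemma mean_int_lin (a c : R) f g : continuous f -> continuous g ->
  mean_int (fun t => a * f t + c * g t) = a * mean_int f + c * mean_int g.
Proof.
move=> cf cg; rewrite /mean_int.
have caf : continuous (fun t => a * f t) by move=> t; apply: cvgMl_tmp; exact: cf.
have cag : continuous (fun t => c * g t) by move=> t; apply: cvgMl_tmp; exact: cg.
rewrite RintegralD//; try exact: cont_integrable.
by rewrite !RintegralZl//; try exact: cont_integrable; ring.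
Qed.

Lemma mean_int_cst (a : R) : mean_int (fun=> a) = a.
Proof.
rewrite /mean_int Rintegral_cst//= lebesgue_measure_itv/= lte_fin twopi_gt0.
by rewrite -EFinD /= subr0 mulrCA mulVf ?mulr1// gt_eqF// twopi_gt0.
Qed.

Lemma mean_int_bound f e : continuous f -> (forall t, `|f t| <= e) -> `|mean_int f| <= e.
Proof.
move=> cf h.
have cnf : continuous (fun t => `|f t|).
  by move=> t; apply: cvg_norm; exact: cf.
rewrite -[leRHS](mean_int_cst e) /mean_int normrM ger0_norm ?invr_ge0 ?(ltW twopi_gt0)//.
rewrite ler_wpM2l ?invr_ge0 ?(ltW twopi_gt0)//.
apply: le_trans (le_normr_Rintegral _ _) _ => //; first exact: cont_integrable.
apply: le_Rintegral => //; apply: cont_integrable => //.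
by move=> t; exact: cvg_cst.
Qed.

Lemma mean_int_FTC (F f : R -> R) : continuous f ->
  (forall x : R, is_derive x (1 : R) F (f x)) -> F (2 * pi) = F 0 -> mean_int f = 0.
Proof.
move=> cf dF e; rewrite /mean_int /Rintegral (@continuous_FTC2 _ _ F)//.
- by rewrite e -EFinB subrr /= mulr0.
- exact: twopi_gt0.
- exact: continuous_subspaceT.
- have cF : continuous F.
    by move=> x; apply: differentiable_continuous; apply/derivable1_diffP; case: (dF x).
  split.
  + by move=> x _; case: (dF x).
  + by apply: cvg_at_right_filter; exact: cF.
  + by apply: cvg_at_left_filter; exact: cF.
- by move=> x _; rewrite derive1E; case: (dF x).
Qed.

(** With real radii, continuity on the circle combines directly with the
    real-valued bounds on states. *)
Definition ccont (g : C -> C) : Prop :=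
  forall a, Circle a -> forall e : R, 0 < e -> exists2 r : R, 0 < r &
    forall c, Circle c -> cmod (c - a) < r -> cmod (g c - g a) < e.

Lemma CircleP (a : C) : Circle a <-> cmod a = 1.
Proof.
rewrite /Circle /= cnormE; split=> [/(congr1 (@cRe R))//|->//].
Qed.

Lemma Circle_expi (t : R) : Circle (expi t).
Proof. by apply/CircleP; rewrite /cmod /absq cRemk cImmk cos2Dsin2 sqrtr1. Qed.

Lemma ccont_within g : ccont g -> {within @Circle R, continuous g}.
Proof.
move=> hg; apply/subspace_continuousP => a Ca; apply/cvgrPdist_lt => e.
rewrite cltE => /andP[/eqP e1 e0]; have [r r0 hr] := hg a Ca _ e0.
have r0' : 0 < (mkC r 0 : C) by rewrite cltE eqxx.
rewrite near_withinE; apply: filterS (nbhsx_ballx a (mkC r 0) r0') => c /= hac Cc.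
rewrite cnormE cltE /= e1 eqxx /= cmodBC; apply: hr => //.
by move: hac; rewrite /ball /= cnormE cltE /= => /andP[_]; rewrite cmodBC.
Qed.

Lemma ccont_expi g : ccont g ->
  continuous (fun t => cRe (g (expi t))) /\ continuous (fun t => cIm (g (expi t))).
Proof.
move=> hg.
have key (t : R) (e : R) : 0 < e -> \forall s \near t, cmod (g (expi s) - g (expi t)) < e.
  move=> e0; have [r r0 hr] := hg _ (Circle_expi t) _ e0.
  have r2 : 0 < r / 2 by rewrite divr_gt0.
  have /cvgrPdist_lt/(_ _ r2) hcos := @continuous_cos R t.
  have /cvgrPdist_lt/(_ _ r2) hsin := @continuous_sin R t.
  near=> s; apply: hr; first exact: Circle_expi.
  apply: le_lt_trans (cmod_le _) _; rewrite (splitr r).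
  rewrite cReD cImD cReN cImN !cRemk !cImmk ltrD//.
    by rewrite distrC; near: s; exact: hcos.
  by rewrite distrC; near: s; exact: hsin.
split=> t; apply/cvgrPdist_lt => e e0; apply: filterS (key t e e0) => s;
  apply: le_lt_trans; rewrite distrC.
  by rewrite -cReN -cReD cRe_le_cmod.
by rewrite -cImN -cImD cIm_le_cmod.
Unshelve. all: by end_near. Qed.

Definition has_mean (g : C -> C) (v : C) : Prop := ccont g /\ circle_integral g = v.

Lemma circle_integralE g : circle_integral g =
  mkC (mean_int (fun t => cRe (g (expi t)))) (mean_int (fun t => cIm (g (expi t)))).
Proof. by []. Qed.

Lemma has_mean_ext g h v : (forall a, Circle a -> g a = h a) -> has_mean g v -> has_mean h v.
Proof.
move=> gh [cg <-]; split.
  by move=> a Ca e /(cg a Ca)[r r0 hr]; exists r => // c Cc; rewrite -!gh//; exact: hr.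
rewrite !circle_integralE; congr mkC; congr mean_int; apply/funext => t;
  by rewrite gh//; exact: Circle_expi.
Qed.

Lemma has_mean_lin (a : C) g h v w : has_mean g v -> has_mean h w ->
  has_mean (fun x => a * g x + h x) (a * v + w).
Proof.
move=> [cg <-] [ch <-]; split.
  move=> c Cc e e0; have a1 : 0 < cmod a + 1 by rewrite ltr_wpDl ?cmod_ge0.
  have e1 : 0 < e / 2 / (cmod a + 1) by rewrite !divr_gt0.
  have e2 : 0 < e / 2 by rewrite divr_gt0.
  have [r r0 hr] := cg c Cc _ e1; have [s s0 hs] := ch c Cc _ e2.
  exists (Num.min r s); first by rewrite lt_min r0.
  move=> x Cx; rewrite lt_min => /andP[/(hr x Cx) h1 /(hs x Cx) h2].
  have -> : a * g x + h x - (a * g c + h c) = a * (g x - g c) + (h x - h c) by ring.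
  apply: le_lt_trans (cmodD _ _) _; rewrite (splitr e) cmodM; apply: ler_ltD => //.
  apply: le_trans (_ : (cmod a + 1) * cmod (g x - g c) <= _).
    by rewrite ler_wpM2r ?cmod_ge0// lerDl.
  by rewrite mulrC -ler_pdivlMr// ltW.
have [g1 g2] := ccont_expi cg; have [h1 h2] := ccont_expi ch.
rewrite !circle_integralE; apply: cplx_eq;
  rewrite !(cReD, cImD, cReM, cImM, cRemk, cImmk).
- rewrite -[X in _ = _ + X]mul1r -mulNr -mean_int_lin// -[X in _ = X + _]mul1r -mean_int_lin//.
    congr mean_int; apply/funext => t; rewrite !(cReD, cReM); ring.
  by move=> t; apply: cvgD; apply: cvgMl_tmp; [exact: g1|exact: g2].
- rewrite -[X in _ = _ + X]mul1r -mean_int_lin// -[X in _ = X + _]mul1r -mean_int_lin//.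
    congr mean_int; apply/funext => t; rewrite !(cImD, cImM); ring.
  by move=> t; apply: cvgD; apply: cvgMl_tmp; [exact: g2|exact: g1].
Qed.

Lemma has_mean_cst (c : C) : has_mean (fun=> c) c.
Proof.
split; first by move=> a _ e e0; exists 1 => // x _ _; rewrite subrr cmod0.
by rewrite circle_integralE !mean_int_cst; apply: cplx_eq; rewrite ?cRemk ?cImmk.
Qed.

Lemma has_mean_conj g v : has_mean g v -> has_mean (fun x => (g x)^*) v^*.
Proof.
move=> [cg <-]; split.
  move=> a Ca e /(cg a Ca)[r r0 hr]; exists r => // x Cx /(hr x Cx).
  by rewrite -rmorphB /= cmodC.
have [g1 g2] := ccont_expi cg.
rewrite !circle_integralE; apply: cplx_eq; rewrite !(cReC, cImC, cRemk, cImmk).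
  by congr mean_int; apply/funext => t; rewrite cReC.
rewrite -mulN1r -[RHS]addr0 -(mul0r (mean_int (fun t => cIm (g (expi t))))) -mean_int_lin//.
by congr mean_int; apply/funext => t; rewrite cImC; ring.
Qed.

(** Both halves of the predicate survive uniform limits; this is what makes the
    set of operators satisfying the theorem norm closed. *)
Lemma has_mean_limit g v :
  (forall e : R, 0 < e -> exists h w, [/\ has_mean h w,
     forall a, Circle a -> cmod (g a - h a) <= e & cmod (v - w) <= e]) ->
  has_mean g v.
Proof.
move=> H.
have cg : ccont g.
  move=> a Ca e e0; have e3 : 0 < e / 3 by rewrite divr_gt0.
  have [h [w [[ch _] gh _]]] := H _ e3.
  have [r r0 hr] := ch a Ca _ e3; exists r => // c Cc /(hr c Cc) hc.
  have -> : g c - g a = (g c - h c) + ((h c - h a) + (h a - g a)) by ring.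
  have h1 := gh _ Cc; have := gh _ Ca; rewrite cmodBC => h2.
  apply: le_lt_trans (cmodD _ _) _.
  have := cmodD (h c - h a) (h a - g a); lra.
split=> //; apply/eqP; rewrite -subr_eq0; apply/eqP/cmod_eq0/eqP.
rewrite eq_le cmod_ge0 andbT; apply/ler_addgt0Pl => e e0; rewrite addr0.
have e3 : 0 < e / 3 by rewrite divr_gt0.
have [h [w [mh gh vw]]] := H _ e3.
have [cgh e1] := has_mean_lin (-1) mh (conj cg erefl).
have -> : circle_integral g - v = (-1 * w + circle_integral g) + (w - v) by ring.
apply: le_trans (cmodD _ _) _; rewrite cmodBC -e1 circle_integralE.
have [k1 k2] := ccont_expi cgh.
have b1 (t : R) : cmod (-1 * h (expi t) + g (expi t)) <= e / 3.
  by rewrite mulN1r addrC; exact/gh/Circle_expi.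
have := cmod_le (mkC (mean_int (fun t => cRe (-1 * h (expi t) + g (expi t))))
    (mean_int (fun t => cIm (-1 * h (expi t) + g (expi t))))).
rewrite cRemk cImmk => h3.
have h4 := mean_int_bound k1 (fun t => le_trans (cRe_le_cmod _) (b1 t)).
have h5 := mean_int_bound k2 (fun t => le_trans (cIm_le_cmod _) (b1 t)).
apply: le_trans (lerD h3 vw) _.
lra.
Qed.

Lemma is_derive_scaled (f f' : R -> R) (c k x : R) :
  (forall y : R, is_derive y (1 : R) f (f' y)) ->
  is_derive x (1 : R) (fun t => c * f (k * t)) (c * (f' (k * x) * k)).
Proof.
move=> h; have h1 : is_derive x (1 : R) (fun t => k * t) k.
  by apply: is_derive_eq (is_deriveZ k (is_derive_id x (1 : R))) _; rewrite /GRing.scale /= mulr1.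
exact: (is_deriveZ c (is_derive1_comp (h (k * x)) h1)).
Qed.

Lemma expiX (t : R) k : expi t ^+ k = expi (k%:R * t).
Proof.
elim: k => [|k IH]; first by rewrite expr0 mul0r /expi cos0 sin0.
rewrite exprS IH -natr1 mulrDl mul1r addrC; apply: cplx_eq;
  rewrite ?cReM ?cImM !(cRemk, cImmk) ?cosD ?sinD//; ring.
Qed.

(** The real and imaginary parts along [t |-> e^(it)] are [cos (k t)] and
    [sin (k t)], with periodic primitives. *)
Lemma has_mean_power k : (0 < k)%N -> has_mean (fun a => a ^+ k) 0.
Proof.
move=> k0.
have ccX : ccont (fun a => a ^+ k).
  elim: k {k0} => [|k IH].
    by move=> a _ e e0; exists 1 => // c _ _; rewrite subrr cmod0.
  move=> a Ca e e0; have e2 : 0 < e / 2 by rewrite divr_gt0.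
  have [r r0 hr] := IH a Ca _ e2.
  exists (Num.min r (e / 2)); first by rewrite lt_min r0.
  move=> c Cc; rewrite lt_min => /andP[/(hr c Cc) h1 h2].
  have -> : c ^+ k.+1 - a ^+ k.+1 = c * (c ^+ k - a ^+ k) + (c - a) * a ^+ k.
    by rewrite !exprS; ring.
  apply: le_lt_trans (cmodD _ _) _; rewrite !cmodM cmodX.
  by rewrite (CircleP c).1// (CircleP a).1// expr1n mul1r mulr1 (splitr e) ltrD.
split=> //; rewrite circle_integralE.
have [c1 c2] := ccont_expi ccX.
have kn0 : k%:R != 0 :> R by rewrite pnatr_eq0 -lt0n.
have e1 : expi (k%:R * (2 * pi)) = expi (k%:R * 0 : R).
  rewrite -(expiX (2 * pi)) -(expiX 0) (_ : expi (2 * pi) = expi 0)//.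
  by rewrite /expi mulr_natl sin2pi cos2pi cos0 sin0.
apply: cplx_eq; rewrite ?cRemk ?cImmk ?cRe0 ?cIm0.
  apply: (@mean_int_FTC (fun t => k%:R^-1 * sin (k%:R * t))) => //.
    move=> x; rewrite expiX cRemk.
    have := @is_derive_scaled sin cos k%:R^-1 k%:R x (@is_derive_sin R).
    by rewrite mulrCA mulVf ?mulr1.
  by have := congr1 (@cIm R) e1; rewrite !cImmk => ->.
apply: (@mean_int_FTC (fun t => - k%:R^-1 * cos (k%:R * t))) => //.
  move=> x; rewrite expiX cImmk.
  have := @is_derive_scaled cos (fun y => - sin y) (- k%:R^-1) k%:R x (@is_derive_cos R).
  by rewrite mulrCA !mulNr mulVf// mulrN1 opprK.
by have := congr1 (@cRe R) e1; rewrite !cRemk => ->.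
Qed.

End CircleMean.

(** * Aleksandrov-Clark states *)

Section Cayley.
Variable R : realType.
Local Notation C := (Cplx R).

Lemma has_mean_geometric (c : C) n :
  has_mean (fun a => \sum_(k < n.+1) (a^* * c) ^+ k) 1.
Proof.
elim: n => [|n IH].
  by apply: has_mean_ext (has_mean_cst 1) => a _; rewrite big_ord1 expr0.
have := has_mean_lin (c ^+ n.+1) (has_mean_conj (has_mean_power R (ltn0Sn n))) IH.
rewrite conjC0 mulr0 add0r; apply: has_mean_ext => a _.
by rewrite [RHS]big_ord_recr /= rmorphXn /= addrC exprMn mulrC.
Qed.

Lemma one_sub_ge (x : C) : 1 - cmod x <= cmod (1 - x).
Proof. by rewrite lerBlDr -[leLHS](cmod1 R) -[X in cmod X](subrK x 1) cmodD. Qed.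

(** The function is [2 / (1 - x) - 1] with [x = a^* c], uniformly approximated by
    twice a partial geometric sum minus [1], with error
    [2 |c|^n / (1 - |c|)]. *)
Lemma has_mean_cayley (c : C) : cmod c < 1 ->
  has_mean (fun a => (1 + a^* * c) / (1 - a^* * c)) 1.
Proof.
move=> c1; have c0 := cmod_ge0 c; apply: has_mean_limit => e e0.
have hc : (fun n => 2 / (1 - cmod c) * cmod c ^+ n) @ \oo --> 2 / (1 - cmod c) * 0.
  by apply: cvgMl_tmp; apply: cvg_expr; rewrite ger0_norm.
rewrite mulr0 in hc; move/cvgrPdist_lt/(_ e e0): hc => [N _ /(_ N.+1 (leqnSn N))].
rewrite /= sub0r normrN => /(le_lt_trans (ler_norm _))/ltW hN.
exists (fun a => 2 * (\sum_(k < N.+1) (a^* * c) ^+ k) + (- 1)), (2 * 1 + (- 1)); split.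
- exact: has_mean_lin (has_mean_geometric c N) (has_mean_cst _).
- move=> a /CircleP a1; set x := a^* * c.
  have xc : cmod x = cmod c by rewrite cmodM cmodC a1 mul1r.
  have p : 0 < 1 - cmod c by rewrite subr_gt0.
  have xn : 1 - x != 0.
    apply/negP => /eqP h; have := one_sub_ge x; rewrite h cmod0 xc; lra.
  have -> : (1 + x) / (1 - x) - (2 * (\sum_(k < N.+1) x ^+ k) - 1) =
      2 * x ^+ N.+1 * (1 - x)^-1.
    have -> : x ^+ N.+1 = 1 + (x - 1) * \sum_(k < N.+1) x ^+ k.
      by rewrite -subrX1 addrC subrK.
    by field.
  rewrite !cmodM cmodX xc; apply: le_trans hN.
  have -> : cmod (2 : C) = 2.
    rewrite (_ : 2 = mkC 2 0) ?cmod_real ?ger0_norm//.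
    by apply: cplx_eq; rewrite ?cRemk ?cImmk ?addr0.
  rewrite mulrAC ler_wpM2r ?exprn_ge0// ler_wpM2l//.
  have vE : cmod (1 - x) * cmod (1 - x)^-1 = 1 by rewrite -cmodM divff// cmod1.
  have := one_sub_ge x; rewrite xc => h.
  by rewrite -(ler_pM2l (lt_le_trans p h)) vE ler_pdivlMr// mul1r.
- by rewrite (_ : 1 - _ = 0) ?cmod0 ?(ltW e0)//; ring.
Qed.
End Cayley.

Section ACStates.
Variables (R : realType) (d : nat).
Local Notation C := (Cplx R).
Local Notation op := (op R d).
Variables (b : 'rV[C]_d -> C) (hb1 : forall z, Bd z -> absq (b z) < 1).

Lemma cmod_b_lt1 z : Bd z -> cmod (b z) < 1.
Proof. by move=> /hb1; rewrite -cmod2 expr_lt1 ?cmod_ge0. Qed.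

Lemma ImE_conj (w : C) : 'i * 'Im w = 2^-1 * (w - w^*).
Proof.
by rewrite -[LHS](addKr ('Re w)) -Crect ReE addrC; field.
Qed.

(** The imaginary part is a combination of the function and its conjugate, both
    of mean [1]. *)
Lemma has_mean_cayley_im : has_mean (fun a => 'i * 'Im (cayley b a 0)) 0.
Proof.
have h := has_mean_cayley (cmod_b_lt1 (@Bd0 R d)).
have h1 := has_mean_lin (-1) (has_mean_conj h) h.
have := has_mean_lin 2^-1 h1 (has_mean_cst 0).
rewrite conjC1 mulN1r addNr mulr0 addr0; apply: has_mean_ext => a _.
by rewrite ImE_conj addr0 mulN1r addrC.
Qed.

Variable mu : C -> op -> C.
Hypothesis hmu : forall a, Circle a -> AC_state b a (mu a).

Let K : R := 2 / (1 - cmod (b 0)).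

(** At [z = 0] the Herglotz operator is the identity, so the mass of the state
    is the real part of the transform at [0]. *)
Lemma AC_mass_le a : Circle a -> cRe (mu a id) <= K.
Proof.
move=> Ca; have [_ /(_ 0 (@Bd0 R d))] := hmu Ca; rewrite herglotz0 => e.
have -> : mu a id = cayley b a 0 - 'i * 'Im (cayley b a 0).
  by rewrite [X in _ = X - _]e addrK.
rewrite ImE_conj.
have -> : cRe (cayley b a 0 - 2^-1 * (cayley b a 0 - (cayley b a 0)^*)) =
    cRe (cayley b a 0).
  move: (cayley b a 0) => w; have h : cIm (2^-1 : C) = 0.
    by rewrite cImV -[2]/(1 + 1) cImD cIm1 addr0 oppr0 mul0r.
  by rewrite cReD cReN cReM h mul0r subr0 cReD cReN cReC subrr mulr0 subr0.
apply: le_trans (ler_norm _) _; apply: le_trans (cRe_le_cmod _) _.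
rewrite /cayley cmodM; set x := a^* * b 0.
have xc : cmod x = cmod (b 0) by rewrite cmodM cmodC (CircleP a).1// mul1r.
have p : 0 < 1 - cmod (b 0) by rewrite subr_gt0 cmod_b_lt1//; exact: Bd0.
have h := one_sub_ge x; rewrite xc in h.
have q : 0 < cmod (1 - x) := lt_le_trans p h.
have xn : 1 - x != 0 by apply/negP => /eqP h0; rewrite h0 cmod0 ltxx in q.
have vE : cmod (1 - x) * cmod (1 - x)^-1 = 1 by rewrite -cmodM divff// cmod1.
apply: ler_pM; rewrite ?cmod_ge0//.
  apply: le_trans (cmodD _ _) _; rewrite cmod1 xc; lra.
by rewrite -(ler_pM2l q) vE ler_pdivlMr// mul1r.
Qed.

(** [W] is the subspace of operators for which the conclusion holds; the four
    goals are the closure properties of [SSbar_dense] and its base case. *)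
Lemma has_mean_AC (T : op) : SSbar T -> has_mean (fun a => mu a T) (vacuum T).
Proof.
pose W : set op := fun T => SSbar T /\ has_mean (fun a => mu a T) (vacuum T).
move=> hT; suff /(_ T hT)[] : @SSbar R d `<=` W by [].
have K0 : 0 <= K.
  by rewrite divr_ge0// ltW// subr_gt0 cmod_b_lt1//; exact: Bd0.
apply: SSbar_dense => {T hT}.
- move=> c T U [hT mT] [hU mU]; split; first exact: SSbar_lin.
  have -> : vacuum (c *: T + U)%R = c * vacuum T + vacuum U.
    by rewrite /vacuum opD opZ dotp_linl.
  apply: has_mean_ext (has_mean_lin c mT mU) => a /hmu[ha _].
  by rewrite (state_lin ha).
- move=> T U [hT mT] aU; split; first exact: SSbar_adj hT aU.
  have -> : vacuum U = (vacuum T)^* by rewrite /vacuum aU.2 -dotp_sym.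
  apply: has_mean_ext (has_mean_conj mT) => a /hmu[ha _].
  by rewrite (state_adjoint ha hT aU).
- move=> T bT h; have hT : SSbar T.
    by apply: SSbar_closed => // e /h[U [hU _] bU]; exists U.
  split=> //; apply: has_mean_limit => e e0.
  have K1 : 0 < 2 * K + 1 by rewrite ltr_wpDl// mulr_ge0.
  (* The states are within [2 r K] of each other and the vacuum values within [r]. *)
  pose r := e / (2 * K + 1); have r0 : 0 < r by rewrite divr_gt0.
  have rE : r * (2 * K + 1) = e by rewrite divfK// gt_eqF.
  have rK : 0 <= r * K by rewrite mulr_ge0// ltW.
  have [U [hU mU] bU] := h r r0; exists (fun a => mu a U), (vacuum U); split => //.
    move=> a Ca; have [ha _] := hmu Ca.
    have hD : SSbar (T - U : op)%R by rewrite combE; exact: SSbar_lin.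
    have -> : mu a T - mu a U = mu a (T - U)%R.
      by rewrite combE (state_lin ha)// mulN1r addrC.
    apply: le_trans (state_bound ha hD (ltW r0) bU) _.
    apply: le_trans (_ : 2 * r * K <= _); last by lra.
    by rewrite ler_wpM2l ?AC_mass_le// mulr_ge0// ltW.
  rewrite /vacuum -dotpBl -opB; apply: le_trans (dotp_CS _ _) _.
  rewrite hnorm_xi mulr1; apply: le_trans (bU _) _; rewrite hnorm_xi mulr1; lra.
- move=> z hz; split; first exact: herglotz_SSbar.
  have zB : Bd z.
    rewrite /Bd /=; have -> : \sum_(j < d) `|z 0 j| ^+ 2 =
        mkC (\sum_(j < d) cmod (z 0 j) ^+ 2) 0.
      apply: cplx_eq; rewrite (cRe_sum, cIm_sum) ?cRemk ?cImmk.
        by apply: eq_bigr => j _; rewrite cnormE -mkCX cRemk.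
      by rewrite big1// => j _; rewrite cnormE -mkCX cImmk.
    rewrite cltE cIm1 cImmk eqxx cRe1 cRemk /=.
    apply: le_lt_trans (_ : 2^-1 < 1); last by rewrite invf_lt1// ltr1n.
    apply: (le_trans _ hz); apply: ler_sum => j _.
    rewrite expr2 ler_piMr ?cmod_ge0//.
    apply: le_trans (_ : \sum_(j < d) cmod (z 0 j) <= 1).
      by rewrite (bigD1 j)//= lerDl sumr_ge0// => i _; exact: cmod_ge0.
    by apply: le_trans hz _; rewrite invf_le1// ler1n.
  have [U [_ hE hxi _]] := herglotzE hz.
  have -> : vacuum (herglotz_op z) = 1.
    rewrite /vacuum hE opB opZ hxi scaler_nat mulr2n addrK dotp_xi.
    by rewrite /= /dirac_fun eqxx.
  have := has_mean_lin (-1) has_mean_cayley_im (has_mean_cayley (cmod_b_lt1 zB)).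
  rewrite mulr0 add0r; apply: has_mean_ext => a /hmu[_ /(_ z zB)].
  by rewrite /cayley => ->; rewrite mulN1r addrC addrK.
Qed.
End ACStates.

Theorem theorem2p9 (R : realType) (d : nat) (d_gt0 : (0 < d)%N)
    (H2 : rkhs (@DAkernel R d)) (b : 'rV[Cplx R]_d -> Cplx R)
    (hb : contractive_multiplier H2 b) (hbc : ~ unimodular_constant b)
    (mu : Cplx R -> op R d -> Cplx R)
    (hmu : forall alpha : Cplx R, Circle alpha -> AC_state b alpha (mu alpha))
    (f : op R d) (hf : SSbar f) :
  {within @Circle R, continuous (fun alpha : Cplx R => mu alpha f)} /\
  circle_integral (fun alpha : Cplx R => mu alpha f) = vacuum f.
Proof.
have hb1 := contractive_multiplier_lt1 hb hbc.
have [hc hi] := has_mean_AC hb1 hmu hf.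
by split=> //; exact: ccont_within.
Qed.
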